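(* Let $X_n$ be a sequence of random variables taking values in (isomorphism classes of) finitely generated abelian groups. Let $a$ be a positive integer and let $A$ be the set of isomorphism classes of finite abelian groups with exponent dividing $a$. Suppose that for every $G\in A$, $$\lim_{n\to\infty}\mathbb{E}(\#\operatorname{Sur}(X_n,G))=|\wedge^2G|.$$ Then for every $H\in A$ the limit $\lim_{n\to\infty}\mathbb{P}(X_n\otimes\mathbb{Z}/a\mathbb{Z}\simeq H)$ exists, and for all $G\in A$ we have $$\sum_{H\in A}\lim_{n\to\infty}\mathbb{P}(X_n\otimes\mathbb{Z}/a\mathbb{Z}\simeq H)\,\#\operatorname{Sur}(H,G)=|\wedge^2G|.$$ Moreover, suppose $Y_n$ is a sequence of random variables taking values in finitely generated abelian groups such that for every $G\in A$ we have $\lim_{n\to\infty}\mathbb{E}(\#\operatorname{Sur}(Y_n,G))=|\wedge^2G|$. Then for every $H\in A$, $$\lim_{n\to\infty}\mathbb{P}(X_n\otimes\mathbb{Z}/a\mathbb{Z}\simeq H)=\lim_{n\to\infty}\mathbb{P}(Y_n\otimes\mathbb{Z}/a\mathbb{Z}\simeq H).$$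
   Context: $\operatorname{Sur}(B,C)$ is the set of surjective group homomorphisms $B\to C$. $\wedge^2G$ is the quotient of $G\otimes_{\mathbb{Z}}G$ by the subgroup generated by the elements $g\otimes g$. Tensor products are over $\mathbb{Z}$. The exponent of a finite abelian group $G$ is the smallest positive integer $e$ with $eG=0$. *)

(* Defs.v *)
From HB Require Import structures.
From mathcomp Require Import all_boot all_order all_algebra.
From mathcomp Require Import generic_quotient ring_quotient finmap freeg.
From mathcomp Require Import all_classical all_reals all_analysis.
Import Order.TTheory GRing.Theory Num.Theory.
Set Implicit Arguments.
Unset Strict Implicit.
Unset Printing Implicit Defensive.
Local Open Scope classical_set_scope.
Local Open Scope ring_scope.

Section GeneratedSubgroup.
Variables (M : zmodType) (S : set M).

Definition gen_subgroup : {pred M} := fun x =>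
  `[< forall N : {pred M}, zmod_closed N -> S `<=` [set` N] -> x \in N >].

Lemma gen_subgroup_zmod_closed : zmod_closed gen_subgroup.
Proof.
split=> [|x y /asboolP Hx /asboolP Hy]; apply/asboolP => N [N0 NB] SN //.
by apply: (NB x y); [exact: Hx | exact: Hy].
Qed.

HB.instance Definition _ :=
  GRing.isZmodClosed.Build M gen_subgroup gen_subgroup_zmod_closed.

Definition quot_gen : zmodType := {ideal_quot gen_subgroup}.

Definition quot_gen_pi (x : M) : quot_gen := \pi_({ideal_quot gen_subgroup})%qT x.

End GeneratedSubgroup.

Section Tensor.
Variables B C : zmodType.

Definition tensor_rel : set {freeg (B * C)%type / int} :=
  [set r | exists b b' c, r = << (b + b', c) >> - << (b, c) >> - << (b', c) >>]
  `|`
  [set r | exists b c c', r = << (b, c + c') >> - << (b, c) >> - << (b, c') >>].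

Definition tensor : zmodType := quot_gen tensor_rel.

Definition pure_tensor (b : B) (c : C) : tensor :=
  quot_gen_pi tensor_rel << (b, c) >>.

End Tensor.

Definition wedge2 (G : zmodType) : zmodType :=
  quot_gen (range (fun g : G => pure_tensor g g)).

Definition int_mod (a : nat) : zmodType := quot_gen [set a%:Z].

Definition zmod_iso (B C : zmodType) : Prop :=
  exists f : B -> C, zmod_morphism f /\ bijective f.

Definition Sur (B C : zmodType) : set (B -> C) :=
  [set f | zmod_morphism f /\ range f = setT].

(* Junk value 0 when A is infinite. *)
Definition ncard (T : choiceType) (A : set T) : nat := #|` fset_set A|%fset.

Definition nSur (B C : zmodType) : nat := ncard (@Sur B C).

Definition is_exponent (G : zmodType) (e : nat) : Prop :=
  [/\ (0 < e)%N, forall g : G, g *+ e = 0 &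
      forall k : nat, (0 < k)%N -> (forall g : G, g *+ k = 0) -> (e <= k)%N].

(* A finitely generated abelian group is encoded by finitely many generators and
   an arbitrary set of relators, that is, as a quotient of some Z^r. *)
Record fgpres := FGPres { fgrank : nat; fgrel : set 'rV[int]_fgrank }.

HB.instance Definition _ := gen_eqMixin fgpres.
HB.instance Definition _ := gen_choiceMixin fgpres.

Definition fgpres_group (p : fgpres) : zmodType := quot_gen (@fgrel p).

Lemma zmod_iso_refl (B : zmodType) : zmod_iso B B.
Proof. by exists id; split=> //; exists id. Qed.

Lemma zmod_iso_sym (B C : zmodType) : zmod_iso B C -> zmod_iso C B.
Proof.
move=> [f [fB [g fK gK]]]; exists g; split; last by exists f.
by move=> x y; apply: (can_inj fK); rewrite fB !gK.
Qed.

Lemma zmod_iso_trans (C B D : zmodType) :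
  zmod_iso B C -> zmod_iso C D -> zmod_iso B D.
Proof.
move=> [f [fB fbij]] [g [gB gbij]]; exists (g \o f); split.
  by move=> x y /=; rewrite fB gB.
exact: bij_comp.
Qed.

Definition fgpres_iso (p q : fgpres) : bool :=
  `[< zmod_iso (fgpres_group p) (fgpres_group q) >].

Lemma fgpres_iso_equiv : equiv_class_of fgpres_iso.
Proof.
split=> [p|p q|q p r]; rewrite /fgpres_iso.
- exact/asboolP/zmod_iso_refl.
- by apply/asboolP/asboolP; exact: zmod_iso_sym.
- move=> /asboolP pq /asboolP qr; apply/asboolP.
  exact: zmod_iso_trans pq qr.
Qed.

Canonical fgpres_iso_equivRel := EquivRelPack fgpres_iso_equiv.
Canonical fgpres_iso_encModRel := defaultEncModRel fgpres_iso.

(* Isomorphism classes of finitely generated abelian groups. There are countably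
   many, so the sigma-algebra below is the discrete one. *)
Definition fgab := {eq_quot fgpres_iso}%qT.

HB.instance Definition _ := Choice.on fgab.
HB.instance Definition _ := EqQuotient.on fgab.
HB.instance Definition _ :=
  isPointed.Build fgab (\pi_fgab%qT (@FGPres 0 set0)).
HB.instance Definition _ := @isMeasurable.Build default_measure_display
  fgab discrete_measurable discrete_measurable0
  discrete_measurableC discrete_measurableU.

(* A representative of the class; only isomorphism-invariant properties of it
   are ever used. *)
Coercion fgab_group (G : fgab) : zmodType := fgpres_group (repr G).

Lemma fgab_group_inj (G H : fgab) : zmod_iso G H -> G = H.
Proof.
move=> GH; rewrite -[G]reprK -[H]reprK.
by apply/eqP; rewrite piE; apply/asboolP.
Qed.

Lemma fgab_of_generators (M : zmodType) (r : nat) (v : 'I_r -> M) :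
  (forall x : M, exists c : 'rV[int]_r, x = \sum_i v i *~ c 0 i) ->
  exists G : fgab, zmod_iso G M.
Proof.
move=> vgen; pose phi (c : 'rV[int]_r) := \sum_i v i *~ c 0 i.
have phiB : zmod_morphism phi.
  move=> x y; rewrite /phi -sumrB; apply: eq_bigr => i _.
  by rewrite !mxE mulrzBr.
have phi0 : phi 0 = 0 by rewrite -[0 in LHS](subrr 0) phiB subrr.
pose p := FGPres [set c | phi c = 0].
have kerP x : x \in gen_subgroup (@fgrel p) -> phi x = 0.
  move=> /asboolP H; apply/eqP; apply: (H [pred c | phi c == 0]).
    by split=> [|c c1]; rewrite !inE ?phi0// phiB => /eqP-> /eqP->; rewrite subr0.
  by move=> c /= c0; rewrite inE c0.
have reprP (x y : 'rV[int]_r) :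
    quot_gen_pi (@fgrel p) x = quot_gen_pi (@fgrel p) y -> phi x = phi y.
  move=> /eqP; rewrite /quot_gen_pi -Quotient.idealrBE => /kerP.
  by rewrite phiB => /subr0_eq.
pose f (q : fgpres_group p) : M := phi (repr q).
have piK (q : fgpres_group p) : quot_gen_pi (@fgrel p) (repr q) = q.
  exact: reprK.
have piB (x y : 'rV[int]_r) : quot_gen_pi (@fgrel p) (x - y) =
    quot_gen_pi (@fgrel p) x - quot_gen_pi (@fgrel p) y.
  by rewrite /quot_gen_pi raddfB.
have fB : zmod_morphism f.
  by move=> x y; rewrite /f -phiB; apply: reprP; rewrite piB !piK.
have finj : injective f.
  move=> x y fxy; rewrite -[x]piK -[y]piK; apply/eqP.
  rewrite /quot_gen_pi -Quotient.idealrBE; apply/asboolP => N _; apply => /=.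
  by rewrite phiB [phi _]fxy subrr.
have fsurj m : exists q, f q = m.
  have [c ->] := vgen m; exists (quot_gen_pi (@fgrel p) c).
  by apply: reprP; rewrite piK.
have [g gK] := choice fsurj.
exists (\pi_fgab%qT p).
have /eqP : \pi_fgab%qT (repr (\pi_fgab%qT p)) = \pi_fgab%qT p by rewrite reprK.
rewrite eqmodE => /asboolP iso; apply: zmod_iso_trans iso _.
by exists f; split=> //; exists g => // x; apply: finj; rewrite gK.
Qed.

Definition finite_exp_dvd (a : nat) : set fgab :=
  [set G : fgab | finite_set [set: G] /\ exists2 e, is_exponent G e & (e %| a)%N].

(* Main.v *)
Require Import Defs.
From HB Require Import structures.
From mathcomp Require Import all_boot all_order all_algebra.
From mathcomp Require Import all_fingroup pgroup abelian cyclic.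
From mathcomp Require Import generic_quotient ring_quotient finmap freeg ring lra zify.
From mathcomp Require Import all_classical all_reals all_analysis.
Import Order.TTheory GRing.Theory Num.Theory.
Import numFieldNormedType.Exports.
Set Implicit Arguments.
Unset Strict Implicit.
Unset Printing Implicit Defensive.
Local Open Scope ring_scope.

(** Everything takes place on the laws of the reductions [X ⊗ Z/a], which are
finite and have the same surjections onto groups of exponent dividing [a].
For a surjection [f : X -> H] and a prime [p] dividing [a], let [D] be the
number of [p]-torsion elements of [ker f]; then [f] is bijective iff [D = 1] for
every such [p]. The q-binomial Bonferroni inequality
  | [D = 1] - sum_{k <= j} w_k (D - 1)(D - p) ... (D - p^(k-1)) |
     <= |w_(j+1)| (D - 1) ... (D - p^j),     w_k = (-1)^k / prod_{i=1}^k (p^i - 1),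
sieves out one prime at a time. The sum over [f] of (D - 1) ... (D - p^(k-1)) is,
up to a constant, the number of surjections from [X] onto the iterated extensions
of [H] by [k] copies of [F_p], obtained by pulling back 2-cocycles on [H]; so its
expectation converges. Its limit is bounded because one extension step multiplies
the order of the exterior square of [E] by at most the number [h(E)] of
[p]-torsion elements, the number of cocycles that split over [E] is exactly
proportional to [p^k / h(E)], and non-split steps are rare. The error terms thus
decay geometrically in [j], which gives the existence of the limits.
Uniqueness follows by interleaving the two sequences. In the moment identity no
mass escapes: a surjection from a large group onto [G] has some large [D], and
the sums of [D] over surjections onto [G] have bounded expectation. *)

(** * Counting characters of finite abelian groups *)

(** The margin is thin. For [H = 0] the j-th term of the sieve has, in the limit, absolute value
    [p^(j(j-1)/2)], the order of the exterior square of [F_p^j], divided by [(p - 1) ... (p^j - 1)],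
    so each level gains only about a factor [1/p]. Bounding all cocycles alike would lose at every
    level a constant depending on [H], which this gain cannot absorb in general. The split cocycles
    must therefore be counted exactly, and the non-split ones paid for by a potential: a power of
    [h(E)/p^i] at level [i]. A split step never raises it, while a non-split step divides it by a
    power of [p] large enough to outweigh all cocycles on [H] together. Cocycles are pulled back
    from [H] instead of being chosen on [E] because the number of lifts of a surjection [X -> H],
    summed over them, is then proportional to [D] at every level of the tower. Torsion is counted
    through characters with values in [F_p], because a character that is nonzero on the new fibre
    is, up to a scalar, a splitting. *)

Section Counting.
Variables T T' : finType.

Lemma card_fibers (f : T -> T') (A : {set T}) (B : {set T'}) n :
  (forall x, x \in A -> f x \in B) ->
  (forall y, y \in B -> #|[set x in A | f x == y]| = n) -> #|A| = (#|B| * n)%N.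
Proof.
move=> fAB fib; rewrite -sum1_card (partition_big f (mem B)) //=.
rewrite -sum_nat_const; apply: eq_bigr => y yB.
by rewrite -(fib y yB) -sum1_card; apply: eq_bigl => x; rewrite inE.
Qed.

Lemma card_fibers_le (f : T -> T') (A : {set T}) (B : {set T'}) n :
  (forall x, x \in A -> f x \in B) ->
  (forall y, y \in B -> #|[set x in A | f x == y]| <= n)%N ->
  (#|A| <= #|B| * n)%N.
Proof.
move=> fAB fib; rewrite -sum1_card (partition_big f (mem B)) //=.
rewrite -sum_nat_const; apply: leq_sum => y yB.
rewrite (leq_trans _ (fib y yB)) // -sum1_card.
by apply: eq_leq; apply: eq_bigl => x; rewrite inE.
Qed.

Lemma card_bij_in (f : T -> T') (g : T' -> T) (A : {set T}) (B : {set T'}) :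
  (forall x, x \in A -> f x \in B) -> (forall y, y \in B -> g y \in A) ->
  {in A, cancel f g} -> {in B, cancel g f} -> #|A| = #|B|.
Proof.
move=> fAB gBA fK gK; rewrite -(card_in_imset (can_in_inj fK)).
congr #|pred_of_set _|; apply/setP => y; apply/imsetP/idP => [[x xA ->]|yB].
  exact: fAB.
by exists (g y); rewrite ?gBA// gK.
Qed.

End Counting.

Section AdditiveFunctions.
Variables (X G : zmodType) (f : X -> G).
Hypothesis fD : {morph f : x y / x + y}.

Lemma morphD0 : f 0 = 0.
Proof. by apply: (addrI (f 0)); rewrite -fD !addr0. Qed.

Lemma morphDN x : f (- x) = - f x.
Proof. by apply/eqP; rewrite -addr_eq0 -fD addNr morphD0. Qed.

Lemma morphDB x y : f (x - y) = f x - f y.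
Proof. by rewrite fD morphDN. Qed.

Lemma morphDMn x n : f (x *+ n) = f x *+ n.
Proof. by elim: n => [|n IH]; rewrite ?morphD0// !mulrS fD IH. Qed.

End AdditiveFunctions.

Definition addhom (X G : finZmodType) : {set {ffun X -> G}} :=
  [set f : {ffun X -> G} | [forall x, forall y, f (x + y) == f x + f y]].

Definition surhom (X G : finZmodType) : {set {ffun X -> G}} :=
  [set f in addhom X G | [forall y, exists x, f x == y]].

Definition torker (p : nat) (X G : finZmodType) (f : X -> G) : nat :=
  #|[set x | (f x == 0) && (x *+ p == 0)]|.

Definition tor (p : nat) (X : finZmodType) : nat := #|[set x : X | x *+ p == 0]|.

Section Homs.
Variables X G : finZmodType.

Lemma addhomP (f : {ffun X -> G}) :
  reflect {morph f : x y / x + y} (f \in addhom X G).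
Proof.
rewrite inE; apply: (iffP forallP) => [H x y|H x].
  by have /forallP/(_ y)/eqP := H x.
by apply/forallP => y; rewrite H.
Qed.

Lemma surhomP (f : {ffun X -> G}) :
  reflect ({morph f : x y / x + y} /\ forall y, exists x, f x = y)
          (f \in surhom X G).
Proof.
rewrite inE; apply: (iffP andP) => -[fD fS]; split; try exact/addhomP.
  by move=> y; have /forallP/(_ y)/existsP[x /eqP <-] := fS; exists x.
by apply/forallP => y; have [x <-] := fS y; apply/existsP; exists x.
Qed.

End Homs.

Section Characters.
Variables (p : nat) (p_pr : prime p) (X : finZmodType).

Definition subgrp (W : {set X}) :=
  (0 \in W) && [forall x in W, forall y in W, x - y \in W].

Section SubgrpTheory.
Variables (W : {set X}) (Wg : subgrp W).

Lemma subgrp0 : 0 \in W. Proof. by case/andP: Wg. Qed.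

Lemma subgrpB x y : x \in W -> y \in W -> x - y \in W.
Proof. by case/andP: Wg => _ /forall_inP H xW; move: y; apply/forall_inP/H. Qed.

Lemma subgrpN x : x \in W -> - x \in W.
Proof. by move=> xW; rewrite -sub0r subgrpB// subgrp0. Qed.

Lemma subgrpD x y : x \in W -> y \in W -> x + y \in W.
Proof. by move=> xW yW; rewrite -[y]opprK subgrpB// subgrpN. Qed.

Lemma subgrpMn x n : x \in W -> x *+ n \in W.
Proof. by move=> xW; elim: n => [|n IH]; rewrite ?mulr0n ?subgrp0// mulrS subgrpD. Qed.

End SubgrpTheory.

Lemma subgrp_intro (W : {set X}) : 0 \in W ->
  (forall x y, x \in W -> y \in W -> x - y \in W) -> subgrp W.
Proof.
move=> W0 WB; apply/andP; split=> //; apply/forall_inP => x xW.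
by apply/forall_inP => y yW; exact: WB.
Qed.

(** Characters of a subgroup are stored as functions on all of [X]; the value 0 outside [K] makes
    the encoding unique, so that cardinals are right. *)
Definition chars (K : {set X}) : {set {ffun X -> 'F_p}} :=
  [set chi : {ffun X -> 'F_p} |
    [forall x, (x \notin K) ==> (chi x == 0)] &&
    [forall x in K, forall y in K, chi (x + y) == chi x + chi y]].

Lemma charsP (K : {set X}) (chi : {ffun X -> 'F_p}) :
  reflect ((forall x, x \notin K -> chi x = 0) /\
           (forall x y, x \in K -> y \in K -> chi (x + y) = chi x + chi y))
          (chi \in chars K).
Proof.
rewrite inE; apply: (iffP andP) => -[H1 H2]; split.
- by move=> x xK; apply/eqP; have /forallP/(_ x)/implyP := H1; exact.
- move=> x y xK yK; apply/eqP.
  by have /forall_inP/(_ x xK)/forall_inP/(_ y yK) := H2.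
- by apply/forallP => x; apply/implyP => /H1 ->.
- by apply/forall_inP => x xK; apply/forall_inP => y yK; rewrite H2.
Qed.

(** Elements of ['F_p] act through their representatives below [p], so addition may drop a carry,
    which is a multiple of [p]. *)
Lemma Fp_mulrnE (V : zmodType) (x : V) (k l : 'F_p) : exists q,
  x *+ k + x *+ l = x *+ (k + l)%R + x *+ p *+ q.
Proof.
exists ((k + l) %/ p)%N; rewrite -mulrnA -!mulrnDr; congr (_ *+ _).
have -> : ((k + l)%R : nat) = ((k + l) %% p)%N.
  by congr (_ %% _)%N; exact: Fp_cast.
by rewrite [RHS]addnC [(p * _)%N]mulnC -divn_eq.
Qed.

Lemma FpMn (u : 'F_p) : u *+ p = 0.
Proof. by rewrite -mulr_natr pchar_Fp_0// mulr0. Qed.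

Section Extension.
Variables (K : {set X}) (Kg : subgrp K).
Let pK : {set X} := [set x *+ p | x in K].

(** For [W] between [pK] and [K] these are the characters of [W/pK]; for [W = K] the condition holds
    automatically. *)
Let P (W : {set X}) := [set chi in chars W | [forall x in K, chi (x *+ p) == 0]].

Lemma chars_char0 (W : {set X}) chi : subgrp W -> chi \in chars W -> chi 0 = 0.
Proof.
move=> Wg /charsP[_ chiD]; apply: (addrI (chi 0)).
by rewrite -chiD ?subgrp0// !addr0.
Qed.

Lemma chars_charMn (W : {set X}) chi x n : subgrp W -> chi \in chars W ->
  x \in W -> chi (x *+ n) = chi x *+ n.
Proof.
move=> Wg chiW xW; elim: n => [|n IH]; first by rewrite (chars_char0 Wg).
by have /charsP[_ chiD] := chiW; rewrite !mulrS chiD ?IH// subgrpMn.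
Qed.

(** Adjoin to [W] an [x] of [K] outside it. As [x *+ p] lies in [pK], the new subgroup is [p] times
    larger, and a character vanishing on [pK] extends with an arbitrary value at [x]. *)
Lemma card_chars_step (W : {set X}) : subgrp W -> pK \subset W -> W \proper K ->
  exists W' : {set X}, [/\ subgrp W', W \proper W', W' \subset K,
    #|W'| = (p * #|W|)%N & #|P W'| = (p * #|P W|)%N].
Proof.
move=> Wg pKW /properP[WK [x xK xW]].
have pxW y : y \in K -> y *+ p \in W.
  by move=> yK; apply: (fintype.subsetP pKW); apply: imset_f.
(* Otherwise [W] contains [x *+ m] with [m] prime to [p], besides [x *+ p], and a Bezout relation
   puts [x] itself in [W]. *)
have uniqk (k l : 'F_p) : x *+ k - x *+ l \in W -> k = l.
  move=> klW; apply/eqP; rewrite -subr_eq0; apply/negPn/negP => kl0.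
  have mW : x *+ (k - l)%R \in W.
    have [q] := Fp_mulrnE x (k - l) l; rewrite subrK => E.
    have -> : x *+ (k - l)%R = x *+ k - x *+ l + x *+ p *+ q.
      by rewrite addrAC -E addrK.
    by rewrite subgrpD// subgrpMn// pxW.
  set m := nat_of_ord (k - l) in mW.
  have cop : coprime m p.
    rewrite coprime_sym prime_coprime// gtnNdvd//.
      by rewrite lt0n; apply: contraNneq kl0 => m0; apply/eqP/val_inj.
    by rewrite -[X in (_ < X)%N](Fp_cast p_pr) ltn_ord.
  have m0 : (0 < m)%N.
    by rewrite lt0n; apply: contraNneq kl0 => m0; apply/eqP/val_inj.
  have [u v E _] := egcdnP p m0; move: cop; rewrite /coprime => /eqP g1.
  case/negP: xW; have -> : x = x *+ m *+ u - x *+ p *+ v.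
    by rewrite -!mulrnA [(m * u)%N]mulnC [(p * v)%N]mulnC E mulrnDr addrAC
      subrr add0r g1.
  by rewrite subgrpB// subgrpMn// pxW.
pose W' : {set X} := [set y : X | [exists k : 'F_p, y - x *+ k \in W]].
(* The coordinate of [y] along [x] modulo [W]. *)
pose kk y : 'F_p := odflt 0 [pick k : 'F_p | y - x *+ k \in W].
have kkP y : y \in W' -> y - x *+ kk y \in W.
  rewrite inE => /existsP[k kW]; rewrite /kk.
  by case: pickP => [//|/(_ k)]; rewrite kW.
have kkE y (k : 'F_p) : y - x *+ k \in W -> kk y = k.
  move=> ykW; have yW' : y \in W' by rewrite inE; apply/existsP; exists k.
  apply: uniqk; have -> : x *+ kk y - x *+ k = (y - x *+ k) - (y - x *+ kk y).
    by rewrite opprB [RHS]addrC addrA subrK.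
  by rewrite subgrpB// kkP.
have kkW w : w \in W -> kk w = 0.
  by move=> wW; apply: kkE; rewrite mulr0n subr0.
have WW' w : w \in W -> w \in W'.
  by move=> wW; rewrite inE; apply/existsP; exists 0; rewrite mulr0n subr0.
have F1 : (1 : 'F_p) = 1%N :> nat.
  by [].
have xW' : x \in W'.
  by rewrite inE; apply/existsP; exists 1; rewrite F1 mulr1n subrr subgrp0.
have kkx : kk x = 1.
  by apply: kkE; rewrite F1 mulr1n subrr subgrp0.
have W'D y z : y \in W' -> z \in W' -> (y + z) - x *+ (kk y + kk z)%R \in W.
  move=> yW zW; have [q E] := Fp_mulrnE x (kk y) (kk z).
  have -> : y + z - x *+ (kk y + kk z)%R =
      (y - x *+ kk y) + (z - x *+ kk z) + x *+ p *+ q.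
    by rewrite addrACA -opprD E -[RHS]addrA; congr (_ + _); rewrite opprD -addrA addNr addr0.
  exact: (subgrpD Wg (subgrpD Wg (kkP _ yW) (kkP _ zW)) (subgrpMn Wg q (pxW _ xK))).
have kkD y z : y \in W' -> z \in W' -> kk (y + z) = kk y + kk z.
  by move=> yW zW; apply: kkE; exact: W'D.
have W'N y : y \in W' -> - y \in W'.
  move=> yW; rewrite inE; apply/existsP; exists (- kk y).
  have [q] := Fp_mulrnE x (- kk y) (kk y); rewrite addNr mulr0n add0r => E.
  have -> : - y - x *+ (- kk y)%R = - (y - x *+ kk y) - x *+ p *+ q.
    by rewrite -E opprB opprD [X in _ = X + _]addrC [RHS]addrACA subrr addr0.
  exact: (subgrpB Wg (subgrpN Wg (kkP _ yW)) (subgrpMn Wg q (pxW _ xK))).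
have W'g : subgrp W'.
  apply: subgrp_intro; first by rewrite WW'// subgrp0.
  move=> y z yW zW; rewrite inE; apply/existsP; exists (kk y + kk (- z)).
  by apply: W'D => //; exact: W'N.
have W'K : W' \subset K.
  apply/fintype.subsetP => y /kkP yW.
  by rewrite -(subrK (x *+ kk y) y) subgrpD// ?subgrpMn// (fintype.subsetP WK).
have cardF : #|'F_p| = p by rewrite card_Fp.
exists W'; split=> //.
- by apply/properP; split; [exact/fintype.subsetP | exists x].
- rewrite mulnC -[X in (_ * X)%N]cardF -cardsT -cardsX.
  apply: (@card_bij_in _ _ (fun y => (y - x *+ kk y, kk y))
                           (fun z => z.1 + x *+ z.2)).
  + by move=> y yW; rewrite !inE kkP.
  + move=> [w k]; rewrite !inE /= andbT => wW; apply/existsP; exists k.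
    by rewrite addrK.
  + by move=> y _ /=; rewrite subrK.
  + move=> [w k]; rewrite !inE andbT => wW /=.
    by rewrite (kkE _ k) addrK.
- rewrite mulnC -[X in (_ * X)%N]cardF -cardsT -cardsX.
  pose ff (chi : {ffun X -> 'F_p}) : {ffun X -> 'F_p} * 'F_p :=
    ([ffun w => if w \in W then chi w else 0], chi x).
  pose gg (z : {ffun X -> 'F_p} * 'F_p) : {ffun X -> 'F_p} :=
    [ffun y => if y \in W' then z.1 (y - x *+ kk y) + z.2 *+ kk y else 0].
  apply: (@card_bij_in _ _ ff gg).
  + move=> chi; rewrite inE => /andP[/charsP[chi0 chiD] /forall_inP chip].
    rewrite !inE /= andbT; apply/andP; split.
      apply/andP; split.
        by apply/forallP => y; rewrite ffunE; apply/implyP => /negPf ->.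
      apply/forall_inP => y yW; apply/forall_inP => z zW.
      by rewrite !ffunE yW zW subgrpD// chiD// WW'.
    by apply/forall_inP => y yK; rewrite ffunE pxW// chip.
  + move=> [chi u]; rewrite !inE /= andbT => /andP[chiW /forall_inP chip].
    have {}chiW : chi \in chars W by rewrite inE.
    have /charsP[chi0 chiD] := chiW.
    apply/andP; split; last first.
      by apply/forall_inP => y yK; rewrite ffunE WW' ?pxW//= kkW ?pxW//
        !mulr0n subr0 addr0 chip.
    apply/andP; split.
      by apply/forallP => y; rewrite ffunE; apply/implyP => /negPf ->.
    apply/forall_inP => y yW; apply/forall_inP => z zW.
    rewrite !ffunE yW zW subgrpD//= kkD//.
    have [q E] := Fp_mulrnE x (kk y) (kk z).
    have [q' E'] := Fp_mulrnE u (kk y) (kk z).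
    rewrite FpMn mul0rn addr0 in E'.
    apply/eqP; rewrite addrACA E' -chiD ?kkP//.
    have -> : y - x *+ kk y + (z - x *+ kk z) =
       y + z - x *+ (kk y + kk z)%R - x *+ p *+ q.
      by rewrite addrACA -opprD E opprD [LHS]addrA.
    rewrite [in RHS]chiD; [|exact: W'D|exact: (subgrpN Wg (subgrpMn Wg q (pxW _ xK)))].
    have -> : chi (- (x *+ p *+ q)) = 0.
      rewrite -mulNrn (chars_charMn _ Wg) ?subgrpN ?pxW// -mulNrn.
      by rewrite (eqP (chip _ _)) ?subgrpN// mul0rn.
    by rewrite [in RHS]addr0.
  + move=> chi; rewrite inE => /andP[chiW' /forall_inP chip].
    have /charsP[chi0 chiD] := chiW'.
    apply/ffunP => y; rewrite ffunE /=.
    have [yW|yW] := boolP (y \in W'); last by rewrite chi0.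
    rewrite ffunE kkP// -(chars_charMn _ W'g chiW' xW') -chiD ?subrK//.
      by rewrite WW'// kkP.
    exact: subgrpMn.
  + move=> [chi u]; rewrite !inE /= andbT => /andP[chiW /forall_inP chip].
    have {}chiW : chi \in chars W by rewrite inE.
    have /charsP[chi0 chiD] := chiW.
    congr (_, _); last first.
      by rewrite ffunE xW' kkx F1 mulr1n subrr (chars_char0 Wg)// add0r.
    apply/ffunP => w; rewrite ffunE; case: ifPn => [wW|wW]; last by rewrite chi0.
    by rewrite ffunE WW'//= kkW// !mulr0n subr0 addr0.
Qed.

(** Characters factor through the [F_p]-space [K/pK], which has as many characters as elements; its
    order is that of the [p]-torsion, the kernel of multiplication by [p]. *)
Lemma card_chars : #|chars K| = #|[set x in K | x *+ p == 0]|.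
Proof.
have pKg : subgrp pK.
  apply: subgrp_intro => [|x y /imsetP[u uK ->] /imsetP[v vK ->]].
    by apply/imsetP; exists 0; rewrite ?subgrp0// mul0rn.
  by rewrite -mulrnBl; apply: imset_f; exact: subgrpB.
have pKK : pK \subset K.
  by apply/fintype.subsetP => x /imsetP[u uK ->]; exact: subgrpMn.
have PK : P K = chars K.
  apply/setP => chi; rewrite inE andb_idr// => chiK; apply/forall_inP => x xK.
  by rewrite (chars_charMn _ Kg)// FpMn.
have cardK : #|K| = (#|pK| * #|[set x in K | (x *+ p == 0)%R]|)%N.
  apply: (@card_fibers _ _ (fun x : X => x *+ p)) => [x xK|y /imsetP[u uK ->]].
    exact: imset_f.
  apply: (@card_bij_in _ _ (fun x : X => x - u) (fun x : X => x + u)).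
  - move=> x; rewrite !inE => /andP[xK /eqP E].
    by rewrite subgrpB//= mulrnBl E subrr.
  - move=> x; rewrite !inE => /andP[xK /eqP E].
    by rewrite subgrpD//= mulrnDl E add0r.
  - by move=> x _; rewrite subrK.
  - by move=> x _; rewrite addrK.
have base : (#|P pK| * #|pK| = #|pK|)%N.
  suff -> : P pK = [set [ffun=> 0]] by rewrite cards1 mul1n.
  apply/setP => chi; rewrite inE; apply/andP/set1P => [[chiW /forall_inP chip]|->].
    apply/ffunP => y; rewrite ffunE.
    have [/imsetP[u uK ->]|yW] := boolP (y \in pK); first exact/eqP/chip.
    by have /charsP[-> //] := chiW.
  split; last by apply/forall_inP => x _; rewrite ffunE.
  by apply/charsP; split=> [x _|x y _ _]; rewrite !ffunE ?addr0.
suff: (#|P K| * #|pK| = #|K|)%N.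
  rewrite PK mulnC cardK => /eqP; rewrite eqn_pmul2l => [/eqP //|].
  by apply/card_gt0P; exists 0; exact: subgrp0.
suff H n (W : {set X}) : pK \subset W -> W \subset K ->
    (#|P W| * #|pK| = #|W|)%N -> subgrp W -> (#|K| - #|W| < n)%N ->
    (#|P K| * #|pK| = #|K|)%N.
  by apply: (H (#|K| - #|pK|).+1 pK).
elim: n W => // n IH W pKW WK E Wg; rewrite ltnS => lt.
have [<-//|WnK] := eqVneq W K.
have WpK : W \proper K by rewrite finset.properEneq WnK.
have [W' [W'g WW' W'K cW' cP]] := card_chars_step Wg pKW WpK.
apply: (IH W') => //.
- exact: fintype.subset_trans pKW (proper_sub WW').
- by rewrite cP cW' -mulnA E.
- apply: leq_trans lt; move: (proper_card WW') (subset_leq_card W'K).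
  by move: #|W| #|W'| #|K| => u v w; clear; lia.
Qed.

End Extension.

Lemma card_addhom_Fp : #|addhom X 'F_p| = tor p X.
Proof.
have -> : addhom X 'F_p = chars [set: X]%SET.
  apply/setP => chi; apply/addhomP/charsP => [chiD|[_ chiD] x y].
    by split=> // x; rewrite inE.
  by rewrite chiD ?inE.
rewrite card_chars; first by apply: fintype.eq_card => x; rewrite !inE.
by apply: subgrp_intro => *; rewrite inE.
Qed.

End Characters.

(** * Extensions by 'F_p given by 2-cocycles *)

Section Extensions.
Variables (p : nat).

(** Symmetry makes the extension abelian; the normalisation makes [(0, 0)] its zero. *)
Record cocycle (E : zmodType) := Cocycle {
  cocycle_fun :> E -> E -> 'F_p;
  cocycleC : forall x y, cocycle_fun x y = cocycle_fun y x;
  cocycleA : forall x y z, cocycle_fun x y + cocycle_fun (x + y) z =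
                           cocycle_fun y z + cocycle_fun x (y + z);
  cocycle0 : forall x, cocycle_fun 0 x = 0 }.

(** The parameter [c] lets each cocycle carry its own group law on the same set of pairs. *)
Definition ext (E : zmodType) (c : cocycle E) : Type := (E * 'F_p)%type.

Section ExtZmod.
Variables (E : zmodType) (c : cocycle E).
Implicit Types z w : ext c.

HB.instance Definition _ := Choice.on (ext c).

Definition ext_add z w : ext c := (z.1 + w.1, z.2 + w.2 + c z.1 w.1).
Definition ext_zero : ext c := (0, 0).
Definition ext_opp z : ext c := (- z.1, - z.2 - c z.1 (- z.1)).

Lemma ext_addA : associative ext_add.
Proof.
move=> x y z; rewrite /ext_add /= addrA; congr (_, _).
have -> : c x.1 (y.1 + z.1) =
    c x.1 y.1 + c (x.1 + y.1) z.1 - c y.1 z.1 by rewrite cocycleA addrAC subrr add0r.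
by ring.
Qed.

Lemma ext_addC : commutative ext_add.
Proof.
by move=> x y; rewrite /ext_add addrC (addrC x.2) cocycleC.
Qed.

Lemma ext_add0 : left_id ext_zero ext_add.
Proof. by case=> x u; rewrite /ext_add /= cocycle0 !add0r addr0. Qed.

Lemma ext_addN : left_inverse ext_zero ext_opp ext_add.
Proof.
case=> x u; rewrite /ext_add /ext_zero /= addNr; congr (_, _).
by rewrite (cocycleC c (- x)) -addrA addrACA addNr addNr addr0.
Qed.

HB.instance Definition _ :=
  GRing.isZmodule.Build (ext c) ext_addA ext_addC ext_add0 ext_addN.

Lemma extD1 z w : (z + w).1 = z.1 + w.1. Proof. by []. Qed.
Lemma extD2 z w : (z + w).2 = z.2 + w.2 + c z.1 w.1. Proof. by []. Qed.

Lemma ext_vertMn u n : ((0, u) : ext c) *+ n = (0, u *+ n).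
Proof.
elim: n => [//|n IH]; rewrite mulrS IH; apply/eqP.
by rewrite -pair_eqE /pair_eq extD1 extD2 cocycle0 !addr0 -mulrS !eqxx.
Qed.

Definition ext_fst z : E := z.1.
Lemma ext_fst_is_zmod_morphism : zmod_morphism ext_fst.
Proof. by []. Qed.
HB.instance Definition _ :=
  GRing.isZmodMorphism.Build (ext c) E ext_fst ext_fst_is_zmod_morphism.

End ExtZmod.

HB.instance Definition _ (E : finZmodType) (c : cocycle E) := Finite.on (ext c).

Section Pull.
Variables (E H : zmodType) (pi : {additive E -> H}) (c : cocycle H).
Definition pull : cocycle E.
Proof.
exists (fun x y => c (pi x) (pi y)) => [x y|x y z|x].
- exact: cocycleC.
- by rewrite !raddfD cocycleA.
- by rewrite raddf0 cocycle0.
Defined.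
End Pull.

End Extensions.


Section Lifts.
Variables (p a : nat).

Definition cocycleb (H : finZmodType) (c : {ffun H * H -> 'F_p}) :=
  [&& [forall x, forall y, c (x, y) == c (y, x)],
      [forall x, forall y, forall z,
         c (x, y) + c (x + y, z) == c (y, z) + c (x, y + z)] &
      [forall x, c (0, x) == 0]].

Lemma cocyclebP (H : finZmodType) (c : {ffun H * H -> 'F_p}) :
  reflect [/\ forall x y, c (x, y) = c (y, x),
              forall x y z, c (x, y) + c (x + y, z) = c (y, z) + c (x, y + z) &
              forall x, c (0, x) = 0] (cocycleb c).
Proof.
apply: (iffP and3P) => -[H1 H2 H3]; split.
- by move=> x y; apply/eqP; move: y; apply/forallP; move: x; exact/forallP.
- move=> x y z; apply/eqP; move: z; apply/forallP; move: y; apply/forallP.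
  by move: x; exact/forallP.
- by move=> x; apply/eqP; move: x; exact/forallP.
- by apply/forallP => x; apply/forallP => y; rewrite H1.
- by apply/forallP => x; apply/forallP => y; apply/forallP => z; rewrite H2.
- by apply/forallP => x; rewrite H3.
Qed.

(** A finite type of cocycles, so that one can sum over them. *)
Definition cocycles (H : finZmodType) :=
  {c : {ffun H * H -> 'F_p} | cocycleb c}.

Definition to_cocycle (H : finZmodType) (c : cocycles H) : cocycle p H.
Proof.
exists (fun x y => val c (x, y)); by case/cocyclebP: (valP c).
Defined.

Lemma to_cocycleE (H : finZmodType) (c : cocycles H) x y :
  to_cocycle c x y = val c (x, y).
Proof. by []. Qed.

(** Moments are prescribed only for groups of exponent dividing [a], so the extension has to stay
    among them. *)
Definition kills (H : finZmodType) (c : cocycles H) :=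
  [forall z : ext (to_cocycle c), z *+ a == 0].

(** The condition says that [x |-> (f x, b x)] is additive into [ext c]: these are the lifts of [f]
    to the extension. *)
Definition lifts (X H : finZmodType) (f : X -> H) (c : cocycle p H) :
    {set {ffun X -> 'F_p}} :=
  [set b : {ffun X -> 'F_p} |
    [forall x, forall y, b (x + y) == b x + b y + c (f x) (f y)]].

Lemma liftsP (X H : finZmodType) (f : X -> H) (c : cocycle p H)
    (b : {ffun X -> 'F_p}) :
  reflect (forall x y, b (x + y) = b x + b y + c (f x) (f y)) (b \in lifts f c).
Proof.
rewrite inE; apply: (iffP forallP) => [h x y|h x].
  by have /forallP/(_ y)/eqP := h x.
by apply/forallP => y; rewrite h.
Qed.

Section CardLifts.
Variables (X H : finZmodType) (f : {additive X -> H}).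
Hypotheses (p_pr : prime p) (p_a : (p %| a)%N) (f_surj : forall h, exists x, f x = h).
Hypothesis aX : forall x : X, x *+ a = 0.

Let K : {set X} := [set x | f x == 0].

Let Kg : subgrp K.
Proof.
apply: subgrp_intro => [|x y]; rewrite !inE ?raddf0// => /eqP fx /eqP fy.
by rewrite raddfB /= fx fy subr0.
Qed.

Let B : {set {ffun X -> 'F_p}} := [set b : {ffun X -> 'F_p} |
  [forall x, forall k in K, b (x + k) == b x + b k]].

Let BP (b : {ffun X -> 'F_p}) :
  reflect (forall x k, f k = 0 -> b (x + k) = b x + b k) (b \in B).
Proof.
rewrite inE; apply: (iffP forallP) => [h x k fk|h x].
  by have /forall_inP/(_ k) := h x; rewrite inE fk eqxx => /(_ isT)/eqP.
by apply/forall_inP => k; rewrite inE => /eqP fk; rewrite h.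
Qed.

Let s (h : H) : X := if h == 0 then 0 else odflt 0 [pick x | f x == h].

Let fs h : f (s h) = h.
Proof.
rewrite /s; case: eqP => [->|_]; first exact: raddf0.
case: pickP => [x /eqP //|no]; have [x fx] := f_surj h.
by move: (no x); rewrite fx eqxx.
Qed.

(** A function in [B] amounts to a character of [ker f], of which there are [torker p f], and its
    values on the section [s]. Since [s 0 = 0], the value at [0] is forced to vanish, which leaves
    [#|H|.-1] free values. *)
Let card_B : #|B| = (p ^ #|H|.-1 * torker p f)%N.
Proof.
have -> : torker p f = #|chars p K|.
  by rewrite card_chars//; apply: fintype.eq_card => x; rewrite !inE.
have -> : (p ^ #|H|.-1)%N =
    #|[set g : {ffun H -> 'F_p} | g 0 == 0]|.
  rewrite (_ : [set g | _] =
      [set g in pffun_on (0 : 'F_p) (predC1 (0 : H)) predT]).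
    by rewrite cardsE card_pffun_on cardC1 card_Fp.
  apply/setP => g; rewrite !inE; apply/eqP/pffun_onP => [g0|[/supportP g0 _]].
    by split=> [|//]; apply/supportP => x; rewrite inE negbK => /eqP ->.
  by apply: g0; rewrite !inE eqxx.
rewrite -cardsX.
pose ff (b : {ffun X -> 'F_p}) : {ffun H -> 'F_p} * {ffun X -> 'F_p} :=
  ([ffun h => b (s h)], [ffun x => if x \in K then b x else 0]).
pose gg (z : {ffun H -> 'F_p} * {ffun X -> 'F_p}) : {ffun X -> 'F_p} :=
  [ffun x => z.2 (x - s (f x)) + z.1 (f x)].
have sK x : x - s (f x) \in K by rewrite inE raddfB /= fs subrr.
have s0 : s 0 = 0 by rewrite /s eqxx.
have B0 b : b \in B -> b 0 = 0.
  by move=> /BP bD; apply: (addrI (b 0)); rewrite -bD ?raddf0// !addr0.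
apply: (@card_bij_in _ _ ff gg).
- move=> b bB; have /BP bD := bB.
  rewrite !inE ffunE s0 B0// eqxx /=; apply/andP; split.
    by apply/forallP => x; apply/implyP; rewrite ffunE => /negPf ->.
  apply/forall_inP => x xK; apply/forall_inP => y yK.
  by rewrite !ffunE xK yK (subgrpD Kg)// bD//; move: yK; rewrite inE => /eqP.
- move=> [g chi]; rewrite finset.in_setX inE /= => /andP[/eqP g0 chiK].
  have /charsP[_ chiD] := chiK.
  apply/BP => x k fk; rewrite !ffunE /= raddfD /= fk addr0 s0 subr0 g0 addr0.
  rewrite [RHS]addrAC; congr (_ + _); rewrite -chiD ?sK ?inE ?fk//.
  by rewrite addrAC.
- move=> b /BP bD; apply/ffunP => x; rewrite !ffunE /= sK addrC -bD.
    by rewrite addrC subrK.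
  by apply/eqP; have := sK x; rewrite inE.
- move=> [g chi]; rewrite finset.in_setX inE /= => /andP[/eqP g0 chiK].
  have /charsP[chi0 chiD] := chiK.
  congr (_, _); apply/ffunP => x; rewrite !ffunE /=.
    by rewrite fs subrr (chars_char0 Kg)// add0r.
  case: ifPn => [|/chi0 ->//]; rewrite inE => /eqP fx.
  by rewrite fx s0 subr0 g0 addr0.
Qed.

(* A lift is exactly a function [b] with [b (x + k) = b x + b k] for [k] in
   [ker f]; it determines the cocycle because [f] is onto. *)
Lemma card_lifts :
  (\sum_(c : cocycles H | kills c) #|lifts f (to_cocycle c)| =
   p ^ #|H|.-1 * torker p f)%N.
Proof.
rewrite -card_B.
under eq_bigr do rewrite -sum1_card.
rewrite (exchange_big_dep predT)//= -sum1_card.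
rewrite [RHS]big_mkcond /=; apply: eq_bigr => b _.
case: ifPn => [bB|bB]; last first.
  rewrite big_pred0// => c; apply/negbTE; apply: contra bB => /andP[_ /liftsP bc].
  apply/BP => x k fk; rewrite bc fk cocycleC cocycle0 addr0 //.
have /BP bD := bB.
(* The coboundary of [b] depends only on the images under [f]; the section rewrites it as a function
   on [H]. *)
pose c0 : {ffun H * H -> 'F_p} :=
  [ffun z => b (s z.1 + s z.2) - b (s z.1) - b (s z.2)].
have c0E x y : c0 (f x, f y) = b (x + y) - b x - b y.
  rewrite ffunE /=; set u := s _; set v := s _.
  have fu : f (x - u) = 0 by rewrite raddfB /= fs subrr.
  have fv : f (y - v) = 0 by rewrite raddfB /= fs subrr.
  have xyE : x + y = (u + v) + (x - u) + (y - v).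
    by rewrite [u + v]addrC -(addrA v) (addrC u) subrK [v + x]addrC -addrA
      [v + _]addrC subrK.
  have bxy : b (x + y) = b (u + v) + b (x - u) + b (y - v).
    by rewrite xyE (bD _ _ fv) (bD _ _ fu).
  have bx : b x = b u + b (x - u) by rewrite -(bD _ _ fu) addrC subrK.
  have by' : b y = b v + b (y - v) by rewrite -(bD _ _ fv) addrC subrK.
  by rewrite bxy bx by'; ring.
have c0P : cocycleb c0.
  apply/cocyclebP; split.
  - by move=> x y; rewrite !ffunE /= [s y + s x]addrC addrAC.
  - move=> x y z; rewrite -(fs x) -(fs y) -(fs z) -!raddfD !c0E !addrA.
    by ring.
  - move=> x; rewrite -(fs x) -(raddf0 f) c0E add0r addrAC subrr sub0r.
    apply/eqP; rewrite oppr_eq0; apply/eqP.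
    by apply: (addrI (b 0)); rewrite -bD ?raddf0// !addr0.
pose c1 : cocycles H := exist _ c0 c0P.
have bc1 : b \in lifts f (to_cocycle c1).
  by apply/liftsP => x y; rewrite to_cocycleE c0E; ring.
(* Every element is the image of one of [X], killed by [a], plus a vertical one, killed by [p] and
   hence by [a]. *)
have k1 : kills c1.
  pose g x : ext (to_cocycle c1) := (f x, b x).
  have gD : {morph g : x y / x + y}.
    move=> x y; apply/eqP; rewrite -pair_eqE /pair_eq extD1 extD2 /g.
    by rewrite raddfD eqxx andTb; have /liftsP -> := bc1.
  have g2 u : ((0, u) : ext (to_cocycle c1)) *+ a = 0.
    rewrite ext_vertMn; have /dvdnP[q ->] := p_a.
    by rewrite mulnC mulrnA FpMn// mul0rn.
  apply/forallP => -[h u].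
  have -> : ((h, u) : ext (to_cocycle c1)) = g (s h) + (0, u - b (s h)).
    apply/eqP; rewrite -pair_eqE /pair_eq extD1 extD2 /g addr0 fs eqxx andTb.
    by rewrite cocycleC cocycle0 addr0 addrC subrK.
  by rewrite mulrnDl -(morphDMn gD) aX g2 addr0 (morphD0 gD).
rewrite (big_pred1 c1)// => c /=.
apply/andP/eqP => [[_ /liftsP bc]|->//].
apply/val_inj/ffunP => -[x y]; rewrite -(fs x) -(fs y) -!to_cocycleE [RHS]to_cocycleE c0E.
by rewrite bc; ring.
Qed.

End CardLifts.

End Lifts.

Lemma lifts0 p (X H : finZmodType) (f : X -> H) (c : cocycle p H)
  (b : {ffun X -> 'F_p}) : f 0 = 0 -> b \in lifts f c -> b 0 = 0.
Proof.
move=> f0 /liftsP bD; apply: (addrI (b 0)).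
by have := bD 0 0; rewrite f0 cocycle0 !addr0 => <-.
Qed.

(** * Towers of extensions over [H], and lifting surjections along them *)

Section Covers.
Variables (p a : nat) (p_pr : prime p) (p_a : (p %| a)%N).

(** What survives of [i] successive extensions by [F_p]: a kernel that is elementary abelian of
    order [p^i]. It stays elementary because the cocycles come from [H]. *)
Record is_cover (i : nat) (E H : finZmodType) (pi : E -> H) : Prop := IsCover {
  cover_surj : forall h, exists x, pi x = h;
  cover_kill : forall x : E, x *+ a = 0;
  cover_card : #|[set x | pi x == 0]| = (p ^ i)%N;
  cover_tor : forall x, pi x = 0 -> x *+ p = 0 }.

Lemma cover_id (H : finZmodType) :
  (forall x : H, x *+ a = 0) -> is_cover 0 (@idfun H).
Proof.
move=> aH; split=> // [h| |x /= ->]; [by exists h | | exact: mul0rn].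
by rewrite expn0 -(cards1 (0 : H)); apply: fintype.eq_card => x; rewrite !inE.
Qed.

Section OneCover.
Variables (i : nat) (E H : finZmodType) (pi : {additive E -> H}).
Hypothesis piC : is_cover i pi.

Lemma torker_cover : torker p pi = (p ^ i)%N.
Proof.
rewrite -(cover_card piC); apply: fintype.eq_card => x; rewrite !inE.
by rewrite andb_idr// => /eqP /(cover_tor piC) ->.
Qed.

Lemma cover_le_tor : (p ^ i <= tor p E)%N.
Proof.
rewrite -torker_cover; apply: subset_leq_card.
by apply/fintype.subsetP => x; rewrite !inE => /andP[].
Qed.

Lemma tor_cover_le : (tor p E <= tor p H * p ^ i)%N.
Proof.
apply: (@card_fibers_le _ _ pi) => [x|y _].
  by rewrite !inE => /eqP xp; rewrite -raddfMn /= xp raddf0.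
rewrite -(cover_card piC).
have [->|[x0 ]] := set_0Vmem [set x in [set x | x *+ p == 0] | pi x == y].
  by rewrite cards0.
rewrite !inE => /andP[_ /eqP px0].
rewrite -[X in (X <= _)%N](card_imset _ (addIr (- x0))); apply: subset_leq_card.
apply/fintype.subsetP => _ /imsetP[x + ->]; rewrite !inE => /andP[_ /eqP px].
by rewrite raddfB /= px px0 subrr.
Qed.

Section Ext.
Variable c : cocycles p H.
Let c' := pull pi (to_cocycle c).

Lemma cover_ext : kills a c -> is_cover i.+1 (pi \o @ext_fst p E c').
Proof.
move=> kc; split.
- by move=> h; have [x <-] := cover_surj piC h; exists (x, 0).
(* The first coordinate of [z *+ a] dies in [E]; the second can be computed in the extension of [H],
   where [kills] applies. *)
- move=> z; pose g (z : ext c') : ext (to_cocycle c) := (pi z.1, z.2).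
  have gD : {morph g : x y / x + y}.
    move=> x y; apply/eqP; rewrite -pair_eqE /pair_eq extD1 extD2 /g.
    by rewrite extD1 extD2 /= raddfD !eqxx.
  have [z1E z2E] : (z *+ a).1 = z.1 *+ a /\ (z *+ a).2 = (g z *+ a).2.
    split; first exact: (raddfMn (@ext_fst p E c')).
    by rewrite -(morphDMn gD).
  apply/eqP; rewrite -pair_eqE /pair_eq z1E z2E (cover_kill piC) eqxx.
  by have /forallP/(_ (g z))/eqP -> := kc; rewrite eqxx.
- rewrite expnSr -(cover_card piC) -[X in (_ * X)%N](card_Fp p_pr) -cardsT.
  rewrite -cardsX; apply: fintype.eq_card => -[x u].
  by rewrite finset.in_setX !inE andbT.
- move=> [x u] /= pix; have px := cover_tor piC pix.
  (* Above the kernel of [pi] the pulled-back cocycle vanishes, so multiples are taken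
     coordinatewise. *)
  have E1 n : ((x, u) : ext c') *+ n = (x *+ n, u *+ n).
    elim: n => [//|n IH]; rewrite mulrS IH.
    apply/eqP; rewrite -pair_eqE /pair_eq extD1 extD2 /= -mulrS eqxx /=.
    rewrite -to_cocycleE raddfMn pix mul0rn.
    by rewrite cocycle0 addr0 -mulrS.
  by rewrite E1 px FpMn.
Qed.

Lemma tor_ext_le : (tor p (ext c') <= p * tor p E)%N.
Proof.
rewrite mulnC -[X in (_ * X)%N](card_Fp p_pr).
apply: (@card_fibers_le _ _ (@ext_fst p E c')) => [x|y _].
  by rewrite !inE => /eqP xp; rewrite -raddfMn /= xp raddf0.
rewrite -cardsT -[X in (X <= _)%N](@card_in_imset _ _ snd).
  by apply: subset_leq_card; apply/fintype.subsetP => x; rewrite inE.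
move=> [x u] [x' u']; rewrite !inE /ext_fst /= => /andP[_ /eqP ->].
by move=> /andP[_ /eqP ->] ->.
Qed.

(** Compare characters instead of torsion elements. A character of the extension with value [l != 0]
    at [(0, 1)] becomes, after multiplication by [- l^-1], a lift of [pi]; without lifts every
    character comes from [E]. *)
Lemma tor_ext_nonsplit :
  lifts pi (to_cocycle c) = finset.set0 -> (tor p (ext c') <= tor p E)%N.
Proof.
move=> L0; rewrite -!card_addhom_Fp//.
pose r (chi : {ffun ext c' -> 'F_p}) : {ffun E -> 'F_p} :=
  [ffun x => chi (x, 0)].
have decomp (x : E) (u : 'F_p) : ((x, u) : ext c') = ((x, 0) : ext c') + ((0, u) : ext c').
  apply/eqP; rewrite -pair_eqE /pair_eq extD1 extD2 /= addr0 eqxx add0r.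
  by rewrite -to_cocycleE cocycleC raddf0 cocycle0 addr0 eqxx.
have chi0 (chi : {ffun ext c' -> 'F_p}) u : chi \in addhom (ext c') 'F_p ->
    chi (0, u) = 0.
  move=> /addhomP chiD; have chiu n : chi (0, n%:R) = chi (0, 1) *+ n.
    elim: n => [|n IH]; first by rewrite (morphD0 chiD).
    rewrite [in RHS]mulrS -IH -chiD; congr (chi _).
    apply/eqP; rewrite -pair_eqE /pair_eq extD1 extD2 /= addr0 eqxx.
    by rewrite -to_cocycleE raddf0 cocycle0 addr0 mulrS eqxx.
  rewrite -[u]natr_Zp chiu; set l := chi (0, 1).
  have [->|l0] := eqVneq l 0; first by rewrite mul0rn.
  suff : [ffun x => - l^-1 * chi (x, 0)] \in lifts pi (to_cocycle c).
    by rewrite L0 inE.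
  apply/liftsP => x y; rewrite !ffunE -mulrDr -chiD.
  set v := to_cocycle c _ _.
  have -> : ((x, 0) : ext c') + (y, 0) = (x + y, v).
    by apply/eqP; rewrite -pair_eqE /pair_eq extD1 extD2 /= !addr0 add0r !eqxx.
  have chiv : chi (0, v) = l * v.
    by rewrite -[in LHS](natr_Zp v) chiu -/l -mulr_natr natr_Zp.
  rewrite (decomp (x + y) v) chiD chiv mulrDr -addrA.
  have -> : - l^-1 * (l * v) = - v by rewrite mulrA mulNr mulVf// mulN1r.
  by rewrite addNr addr0.
rewrite -(@card_in_imset _ _ r).
  apply: subset_leq_card; apply/fintype.subsetP => _ /imsetP[chi chiH ->].
  have /addhomP chiD := chiH.
  apply/addhomP => x y; rewrite !ffunE -chiD.
  set v := to_cocycle c (pi x) (pi y).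
  have -> : ((x, 0) : ext c') + (y, 0) = (x + y, v).
    by apply/eqP; rewrite -pair_eqE /pair_eq extD1 extD2 /= !addr0 add0r !eqxx.
  by rewrite (decomp (x + y) v) chiD chi0// addr0.
move=> chi chi' chiH chiH' /ffunP rE; apply/ffunP => -[x u].
have /addhomP chiD := chiH; have /addhomP chiD' := chiH'.
by rewrite (decomp x u) chiD chiD' !chi0//; have := rE x; rewrite !ffunE => ->.
Qed.

(** Two lifts differ by a character of [E], so the lifts form a torsor under these. *)
Lemma card_lifts_split : lifts pi (to_cocycle c) != finset.set0 ->
  #|lifts pi (to_cocycle c)| = tor p E.
Proof.
move=> /set0Pn[b0 b0L]; rewrite -card_addhom_Fp//.
have /liftsP b0D := b0L.
apply: (@card_bij_in _ _
   (fun b : {ffun E -> 'F_p} => [ffun x => b x - b0 x] : {ffun E -> 'F_p})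
   (fun b : {ffun E -> 'F_p} => [ffun x => b x + b0 x] : {ffun E -> 'F_p})).
- move=> b /liftsP bD; apply/addhomP => x y; rewrite !ffunE bD b0D; ring.
- move=> b /addhomP bD; apply/liftsP => x y; rewrite !ffunE bD b0D; ring.
- by move=> b _; apply/ffunP => x; rewrite !ffunE subrK.
- by move=> b _; apply/ffunP => x; rewrite !ffunE addrK.
Qed.

Section SurLifts.
Variables (X : finZmodType) (g : {ffun X -> E}).
Hypothesis g_sur : g \in surhom X E.

(* A lift of [g] fails to be onto iff it vanishes on [ker g], i.e. iff it factors
   through a lift of [pi] itself. *)
Lemma card_sur_lifts :
  (#|[set g' in surhom X (ext c') | [ffun x => ext_fst (g' x)] == g]| +
   #|lifts pi (to_cocycle c)| =
   #|lifts (fun x => pi (g x)) (to_cocycle c)|)%N.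
Proof.
have /surhomP[gD gS] := g_sur.
set L := lifts (fun x => pi (g x)) _.
pose N : {set {ffun X -> 'F_p}} :=
  [set b : {ffun X -> 'F_p} | [forall x, (g x == 0) ==> (b x == 0)]].
have NP (b : {ffun X -> 'F_p}) : reflect (forall x, g x = 0 -> b x = 0) (b \in N).
  rewrite inE; apply: (iffP forallP) => [h x gx|h x].
    by have /implyP := h x; rewrite gx eqxx => /(_ isT)/eqP.
  by apply/implyP => /eqP/h ->.
have L0 (b : {ffun X -> 'F_p}) : b \in L -> b 0 = 0.
  by apply: lifts0; rewrite (morphD0 gD) raddf0.
have LD (b : {ffun X -> 'F_p}) x k : b \in L -> g k = 0 -> b (x + k) = b x + b k.
  move=> /liftsP bD gk; rewrite bD gk raddf0 cocycleC cocycle0 addr0 //.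
rewrite -(cardsID N L) addnC; congr (_ + _)%N.
- have [s sK] : exists s : E -> X, cancel s g.
    exists (fun e => odflt 0 [pick x | g x == e]) => e.
    case: pickP => [x /eqP //|no]; have [x gx] := gS e.
    by move: (no x); rewrite gx eqxx.
  apply: (@card_bij_in _ _
    (fun b : {ffun E -> 'F_p} => [ffun x => b (g x)] : {ffun X -> 'F_p})
    (fun b : {ffun X -> 'F_p} => [ffun e => b (s e)] : {ffun E -> 'F_p})).
  + move=> b bL; have /liftsP bD := bL; rewrite inE; apply/andP; split.
      by apply/liftsP => x y; rewrite !ffunE gD bD.
    by apply/NP => x gx; rewrite ffunE gx (lifts0 (raddf0 pi) bL).
  + move=> b; rewrite inE => /andP[bL /NP bN]; have /liftsP bD := bL.
    have bsE x y : g x = g y -> b x = b y.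
      move=> gxy; rewrite -[x](subrK y) addrC LD ?(bN (x - y)) ?addr0//;
      by rewrite (morphDB gD) gxy subrr.
    apply/liftsP => x y; rewrite !ffunE -[in RHS](sK x) -[in RHS](sK y) !sK.
    have -> : b (s (x + y)) = b (s x + s y) by apply: bsE; rewrite gD !sK.
    by rewrite bD !sK.
  + by move=> b _; apply/ffunP => e; rewrite !ffunE sK.
  + move=> b; rewrite inE => /andP[bL /NP bN]; apply/ffunP => x.
    rewrite !ffunE; set y := s _; rewrite -[in RHS](subrK y x) addrC LD//.
      by rewrite (bN (x - y)) ?addr0// (morphDB gD) sK subrr.
    by rewrite (morphDB gD) sK subrr.
- apply: (@card_bij_in _ _
    (fun g' : {ffun X -> ext c'} => [ffun x => (g' x).2] : {ffun X -> 'F_p})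
    (fun b : {ffun X -> 'F_p} => [ffun x => (g x, b x)] : {ffun X -> ext c'})).
  + move=> g'; rewrite inE => /andP[/surhomP[gD' gS'] /eqP/ffunP gE].
    rewrite inE; apply/andP; split; last first.
      apply/liftsP => x y; rewrite !ffunE gD' extD2 /= -to_cocycleE.
      by rewrite -!gE !ffunE.
    apply/negP => /NP bN; have [x gx] := gS' (0, 1).
    have := bN x; rewrite -gE !ffunE gx /= => /(_ erefl)/eqP.
    by rewrite oner_eq0.
  + move=> b; rewrite inE => /andP[bN bL]; rewrite inE.
    apply/andP; split; last by apply/eqP/ffunP => x; rewrite !ffunE.
    have /liftsP bD := bL.
    have gD' : {morph [ffun x => (g x, b x) : ext c'] : x y / x + y}.
      move=> x y; rewrite !ffunE; apply/eqP.
      by rewrite -pair_eqE /pair_eq extD1 extD2 /= gD bD eqxx -to_cocycleE eqxx.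
    apply/surhomP; split=> // -[e v].
    have [k [gk bk]] : exists k, g k = 0 /\ b k != 0.
      move: bN; rewrite inE negb_forall => /existsP[k].
      by rewrite negb_imply => /andP[/eqP gk bk]; exists k.
    have [x0 gx0] := gS e.
    have gkn n : g (k *+ n) = 0 by rewrite (morphDMn gD) gk mul0rn.
    have bkn n : b (k *+ n) = b k *+ n.
      elim: n => [|n IH]; first by rewrite L0.
      by rewrite !mulrSr LD// IH.
    (* Translating [x0] by multiples of [k] keeps [g] and moves [b] by multiples of the invertible
       [b k], so every second coordinate is reached. *)
    exists (x0 + k *+ ((v - b x0) / b k)%R); rewrite ffunE.
    rewrite gD gkn addr0 gx0 LD// bkn -mulr_natr natr_Zp.
    by rewrite mulrCA mulfV// mulr1 addrC subrK.
  + move=> g'; rewrite inE => /andP[_ /eqP/ffunP gE]; apply/ffunP => x.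
    by rewrite !ffunE -gE ffunE; case: (g' x).
  + by move=> b _; apply/ffunP => x; rewrite !ffunE.
Qed.

End SurLifts.

End Ext.

(** The case [X = E], [f = pi] of [card_lifts]. It counts the lifts that fail to be onto, and also
    weighs the split cocycles exactly. *)
Lemma sum_card_lifts :
  (\sum_(c : cocycles p H | kills a c) #|lifts pi (to_cocycle c)| =
   p ^ #|H|.-1 * p ^ i)%N.
Proof.
rewrite (card_lifts p_pr p_a (cover_surj piC) (cover_kill piC)).
by rewrite torker_cover.
Qed.

(** Over all cocycles, [pi \o g] has [torker p (pi \o g)] lifts up to the common factor, and [p ^ i]
    of them are not onto. One more level of the tower thus produces one factor [D - p^i]; the weight
    [u] carries the remaining factors. *)
Lemma sum_sur_ext (R : realFieldType) (X : finZmodType)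
    (u : {ffun X -> E} -> R) : (forall x : X, x *+ a = 0) ->
  \sum_(c : cocycles p H | kills a c)
    \sum_(g in surhom X (ext (pull pi (to_cocycle c))))
      u [ffun x => ext_fst (g x)] =
  (p ^ #|H|.-1)%:R *
  \sum_(g in surhom X E) u g * ((torker p (pi \o g))%:R - (p ^ i)%:R).
Proof.
move=> aX.
transitivity (\sum_(c : cocycles p H | kills a c) \sum_(g in surhom X E)
  u g * (#|lifts (fun x => pi (g x)) (to_cocycle c)|%:R -
         #|lifts pi (to_cocycle c)|%:R)).
  apply: eq_bigr => c kc.
  rewrite (partition_big (fun g : {ffun X -> ext (pull pi (to_cocycle c))} =>
     [ffun x => ext_fst (g x)] : {ffun X -> E}) (mem (surhom X E))) /=; last first.
    move=> g /surhomP[gD gS]; apply/surhomP; split.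
      by move=> x y; rewrite !ffunE gD.
    by move=> e; have [x gx] := gS (e, 0); exists x; rewrite ffunE gx.
  apply: eq_bigr => g gS.
  rewrite -(card_sur_lifts c gS) natrD addrK.
  rewrite (eq_bigr (fun=> u g)) => [|g' /andP[_ /eqP ->]//].
  rewrite sumr_const mulr_natr; congr (_ *+ _).
  by apply: fintype.eq_card => g'; rewrite [RHS]inE.
rewrite exchange_big mulr_sumr; apply: eq_bigr => g gS.
have /surhomP[gD gSS] := gS.
rewrite -mulr_sumr sumrB mulrCA; congr (_ * _).
rewrite mulrBr -!natr_sum sum_card_lifts -!natrM; congr (_%:R - _).
have fB : zmod_morphism (pi \o g).
  by move=> x y; rewrite /= (morphDB gD) raddfB.
pose f : {additive X -> H} :=
  HB.pack (pi \o g) (GRing.isZmodMorphism.Build X H (pi \o g) fB).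
rewrite -(card_lifts p_pr p_a (f := f))// => h.
have [e <-] := cover_surj piC h; have [x <-] := gSS e.
by exists x.
Qed.

End OneCover.
End Covers.

(** * The sieve and the growth of moments *)

Section Sieve.
Variables (R : realType) (p : nat).
Hypothesis p_gt1 : (1 < p)%N.
Local Notation q := (p%:R : R).

(** For [p] prime, [i = 0] and [D = q ^+ d] this counts the injective linear maps from [F_p^j] to
    [F_p^d]. The offset [i] is the level of the tower from which the factors are still to be
    produced. *)
Definition falling (i j : nat) (D : R) : R := \prod_(l < j) (D - q ^+ (i + l)).

Definition sieve_weight (j : nat) : R :=
  (-1) ^+ j / \prod_(i < j) (q ^+ i.+1 - 1).

Lemma q_ge2 : 2 <= q. Proof. by rewrite ler_nat. Qed.

Lemma q_gt0 : 0 < q. Proof. by have := q_ge2; lra. Qed.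

Lemma qX_gt1 i : 1 < q ^+ i.+1.
Proof. by rewrite exprn_egt1//; have := q_ge2; lra. Qed.

Lemma qX_ge1 i : 1 <= q ^+ i.
Proof. by rewrite exprn_ege1//; have := q_ge2; lra. Qed.

Lemma fallingS i j D :
  falling i j.+1 D = (D - q ^+ i) * falling i.+1 j D.
Proof.
rewrite /falling big_ord_recl /= addn0; congr (_ * _).
by apply: eq_bigr => l _; rewrite addnS addSn.
Qed.

Lemma sieve_den_gt0 j : 0 < \prod_(i < j) (q ^+ i.+1 - 1) :> R.
Proof. by apply: prodr_gt0 => i _; rewrite subr_gt0 qX_gt1. Qed.

Lemma norm_sieve_weight j :
  `|sieve_weight j| = (\prod_(i < j) (q ^+ i.+1 - 1))^-1.
Proof.
rewrite /sieve_weight normrM normrX normrN1 expr1n mul1r ger0_norm//.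
by rewrite invr_ge0 ltW// sieve_den_gt0.
Qed.

(** The left side is a Newton interpolation polynomial with nodes [1, q, ..., q^j]: it takes the
    value 1 at [1] and 0 at the other nodes, whence the product. *)
Lemma sieve_sumE j (D : R) :
  \sum_(k < j.+1) sieve_weight k * falling 0 k D =
  \prod_(i < j) ((q ^+ i.+1 - D) / (q ^+ i.+1 - 1)).
Proof.
elim: j => [|j IH].
  by rewrite big_ord_recl !big_ord0 /sieve_weight /falling !big_ord0 addr0 invr1
    !mulr1.
rewrite big_ord_recr /= IH [RHS]big_ord_recr /= fallingS expr0.
rewrite /sieve_weight big_ord_recr /=.
have -> : falling 1 j D = (-1) ^+ j * \prod_(i < j) (q ^+ i.+1 - D).
  rewrite -[j in (-1) ^+ j]card_ord -prodr_const -big_split /=.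
  by apply: eq_bigr => i _; rewrite add1n mulN1r opprB.
rewrite !big_split /= prodfV; set A := \prod_(i < j) (_ - D); set B := \prod_(i < j) _.
have B0 : B != 0 by rewrite gt_eqF// sieve_den_gt0.
have C0 : q ^+ j.+1 - 1 != 0 by rewrite gt_eqF// subr_gt0 qX_gt1.
rewrite exprS mulN1r.
have s1 : (-1) ^+ j * (-1) ^+ j = 1 :> R by rewrite -expr2 sqrr_sign.
have -> : - (-1) ^+ j / (B * (q ^+ j.+1 - 1)) * ((D - 1) * ((-1) ^+ j * A)) =
  - ((-1) ^+ j * (-1) ^+ j) * (A / B * ((D - 1) / (q ^+ j.+1 - 1))).
  by field; rewrite B0 C0.
rewrite s1; field; rewrite B0 C0 //.
Qed.

Lemma falling_ge0 j d : 0 <= falling 0 j (q ^+ d).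
Proof.
have [jd|dj] := leqP j d; last first.
  by rewrite /falling (bigD1 (Ordinal dj))//= add0n subrr mul0r.
apply: prodr_ge0 => i _; rewrite subr_ge0 add0n ler_weXn2l//.
  by have := q_ge2; lra.
by apply: leq_trans jd; exact: ltnW.
Qed.

(** The truncation is exact for [d <= j]. For larger [d] the right side is the left side times
    [(q^d - 1) / (q^(j+1) - 1)], which is at least 1. *)
Lemma sieve_le j d :
  `|(d == 0%N)%:R - \sum_(k < j.+1) sieve_weight k * falling 0 k (q ^+ d)| <=
  `|sieve_weight j.+1| * falling 0 j.+1 (q ^+ d).
Proof.
rewrite sieve_sumE; case: d => [|d] /=.
  rewrite big1 => [|i _]; last first.
    by rewrite expr0 divff// gt_eqF// subr_gt0 qX_gt1.
  by rewrite subrr normr0 mulr_ge0// falling_ge0.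
rewrite sub0r normrN.
have [jd|dj] := leqP j d; last first.
  rewrite (bigD1 (Ordinal dj))//= subrr mul0r mul0r normr0.
  by rewrite mulr_ge0// falling_ge0.
rewrite norm_sieve_weight fallingS expr0 big_split /= prodfV normrM.
rewrite big_ord_recr /=; have := sieve_den_gt0 j.
set B := \prod_(i < j) (_ - 1) => B0.
have -> : `|\prod_(i < j) (q ^+ i.+1 - q ^+ d.+1)| = falling 1 j (q ^+ d.+1).
  rewrite normr_prod; apply: eq_bigr => i _; rewrite add1n distrC ger0_norm//.
  rewrite subr_ge0 ler_weXn2l ?ltnS//; first by have := q_ge2; lra.
  by apply: ltnW; apply: leq_trans jd.
have A0 : 0 <= falling 1 j (q ^+ d.+1).
  apply: prodr_ge0 => i _; rewrite subr_ge0 add1n ler_weXn2l ?ltnS//.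
    by have := q_ge2; lra.
  by apply: ltnW; apply: leq_trans jd.
have C0 : 0 < q ^+ j.+1 - 1 by rewrite subr_gt0 qX_gt1.
rewrite ger0_norm ?invr_ge0 ?(ltW B0)// invfM -mulrA mulrC ler_wpM2l//.
  by rewrite invr_ge0 ltW.
rewrite mulrA ler_peMl// ler_pdivlMl// mulr1 lerD2r ler_weXn2l ?ltnS//.
by have := q_ge2; lra.
Qed.


(** In [5 / 4 = 1 + 1 / 4], the 1 is the exact share of the split cocycles and [1 / 4] the allowance
    for the others. *)
Definition moment_growth (i j : nat) : R :=
  (5 / 4) ^+ j * \prod_(l < j) q ^+ (i + l).

Lemma moment_growthS i j :
  moment_growth i j.+1 = 5 / 4 * q ^+ i * moment_growth i.+1 j.
Proof.
rewrite /moment_growth big_ord_recl /= addn0 exprS.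
rewrite (eq_bigr (fun l : 'I_j => q ^+ (i.+1 + l))); first by ring.
by move=> l _; rewrite addnS addSn.
Qed.

Lemma moment_growth_ge0 i j : 0 <= moment_growth i j.
Proof.
rewrite mulr_ge0 ?exprn_ge0//.
by apply: prodr_ge0 => l _; rewrite exprn_ge0// ltW// q_gt0.
Qed.

(* The factors q^l/(q^(l+1) - 1) are at most 2/3 for l > 0, which beats 5/4. *)
Lemma sieve_error_le j :
  `|sieve_weight j.+1| * moment_growth 0 j.+1 <= 5 / 4 * (5 / 6) ^+ j.
Proof.
rewrite norm_sieve_weight mulrC /moment_growth -[X in X <= _]mulrA -prodf_div.
rewrite -[X in (5 / 4) ^+ X](card_ord j.+1) -prodr_const -big_split /=.
rewrite big_ord_recl /= add0n expr0 expr1 mul1r.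
have q2 := q_ge2.
have q10 : 0 < q - 1 by lra.
apply: ler_pM.
- by rewrite mulr_ge0 ?invr_ge0//; lra.
- apply: prodr_ge0 => i _; rewrite mulr_ge0//.
  rewrite divr_ge0 ?exprn_ge0 ?subr_ge0//.
  by rewrite ltW// qX_gt1.
- by rewrite ler_piMr// invf_le1//; lra.
rewrite -[X in (5 / 6) ^+ X](card_ord j) -prodr_const.
apply: ler_prod => i _; rewrite add0n /bump /= add1n.
have c0 : 0 < q ^+ i.+2 - 1 by rewrite subr_gt0 qX_gt1.
apply/andP; split.
  by rewrite mulr_ge0// divr_ge0 ?(ltW c0)// exprn_ge0.
rewrite mulrA ler_pdivrMr// [q ^+ i.+2]exprS.
have : q <= q ^+ i.+1 by rewrite exprS ler_peMr ?qX_ge1//; lra.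
set x := q ^+ i.+1 => qx.
have : 2 * x <= q * x by rewrite ler_wpM2r//; lra.
by lra.
Qed.

Lemma sieve_error_small (C e : R) : 0 <= C -> 0 < e ->
  exists j, `|sieve_weight j.+1| * (C * moment_growth 0 j.+1) <= e.
Proof.
move=> C0 e0.
have h : ((fun j => (5 / 6 : R) ^+ j) @ \oo --> (0 : R))%classic.
  by apply: cvg_expr; rewrite ger0_norm; lra.
have d0 : 0 < e / (C * (5 / 4) + 1).
  by rewrite divr_gt0//; lra.
have /cvgr0_norm_lt/(_ _ d0)[j _ /(_ j (leqnn j))/=] := h.
rewrite ger0_norm ?exprn_ge0//.
move=> jlt; exists j; rewrite mulrCA.
apply: (le_trans (ler_wpM2l C0 (sieve_error_le j))).
rewrite ltr_pdivlMr in jlt; last lra.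
have x0 : 0 <= (5 / 6 : R) ^+ j by rewrite exprn_ge0//; lra.
by move: ((5 / 6) ^+ j) jlt x0 => x jlt x0; lra.
Qed.

End Sieve.

Section MomentBound.
Variables (R : realType) (p a : nat) (p_pr : prime p) (p_a : (p %| a)%N).
Variable M : finZmodType -> R.
Hypothesis M_ge0 : forall E : finZmodType,
  (forall x : E, x *+ a = 0) -> 0 <= M E.
Hypothesis M_ext : forall (E : finZmodType) (c : cocycle p E),
  (forall z : ext c, z *+ a = 0) -> M (ext c) <= M E * (tor p E)%:R.

Variable H : finZmodType.

(** With this exponent [k], already [k <= p ^ k] absorbs the number of cocycles, the bound
    [tor p H * p ^ i] on [tor p E], and the 4 of the allowance [1 / 4]. *)
Definition tor_exponent : nat :=
  (4 * tor p H * #|{: cocycles p H}|)%N.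

(* Non-split steps do not increase the p-torsion, so they lower this excess;
   its large exponent pays for the number of non-split cocycles. *)
Definition tor_excess (i : nat) (E : finZmodType) : R :=
  ((tor p E)%:R / p%:R ^+ i) ^+ tor_exponent.

Lemma tor_excess_ge0 i E : 0 <= tor_excess i E.
Proof. by rewrite exprn_ge0// divr_ge0 ?exprn_ge0// ler0n. Qed.

Lemma sum_moment_ext (i : nat) (E : finZmodType) (pi : {additive E -> H}) :
  is_cover p a i pi ->
  \sum_(c : cocycles p H | kills a c)
     M (ext (pull pi (to_cocycle c))) *
     tor_excess i.+1 (ext (pull pi (to_cocycle c))) <=
  (p ^ #|H|.-1)%:R * (5 / 4 * p%:R ^+ i) * (M E * tor_excess i E).
Proof.
move=> piC; have p1 := prime_gt1 p_pr.
have q0 : 0 < p%:R :> R by exact: q_gt0.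
set h : R := (tor p E)%:R; set k := tor_exponent.
have h0 : 0 <= h by rewrite ler0n.
have ME0 : 0 <= M E by apply: M_ge0; exact: cover_kill piC.
have T0 := tor_excess_ge0 i E.
pose spl (c : cocycles p H) := lifts pi (to_cocycle c) != finset.set0.
(* Passing to the extension costs [M] a factor at most [h]. The excess does not grow if [c] splits,
   and loses a factor [p ^ k] if it does not. *)
have step (c : cocycles p H) : kills a c ->
    M (ext (pull pi (to_cocycle c))) *
      tor_excess i.+1 (ext (pull pi (to_cocycle c))) <=
    M E * tor_excess i E * (h * (spl c)%:R + h / p%:R ^+ k).
  move=> kc; have Mc := M_ext (cover_kill (cover_ext p_pr piC kc)).
  have Mc0 : 0 <= M (ext (pull pi (to_cocycle c))).
    by apply: M_ge0; exact: (cover_kill (cover_ext p_pr piC kc)).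
  set Tc := tor_excess i.+1 _.
  have Tc0 : 0 <= Tc by exact: tor_excess_ge0.
  apply: (le_trans (ler_wpM2r Tc0 Mc)); rewrite -/h.
  have [c_split|c_nsplit] := boolP (spl c).
    have : Tc <= tor_excess i E.
      rewrite lerXn2r ?nnegrE ?divr_ge0 ?exprn_ge0 ?ler0n//.
      rewrite ler_pdivrMr ?exprn_gt0//.
      have -> : h / p%:R ^+ i * p%:R ^+ i.+1 = (p * tor p E)%:R.
        by rewrite natrM exprS /h; field; rewrite expf_neq0// gt_eqF.
      by rewrite ler_nat tor_ext_le.
    move=> TT; rewrite mulr1 -!mulrA ler_wpM2l// [X in _ <= X]mulrC.
    rewrite mulrDl -[X in X <= _]addr0 lerD ?ler_wpM2l//.
    by rewrite !mulr_ge0// invr_ge0 exprn_ge0// ltW.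
  have : Tc <= tor_excess i E / p%:R ^+ k.
    rewrite -expr_div_n lerXn2r ?nnegrE ?divr_ge0 ?exprn_ge0 ?ler0n//.
    rewrite exprSr invfM mulrA ler_wpM2r ?invr_ge0 ?ler0n//.
    rewrite ler_wpM2r ?invr_ge0 ?exprn_ge0 ?ler0n// ler_nat tor_ext_nonsplit//.
    by apply/eqP; rewrite -[_ == _]negbK.
  move=> TT; rewrite mulr0 add0r -!mulrA ler_wpM2l// [X in _ <= X]mulrCA.
  by rewrite ler_wpM2l.
apply: (le_trans (ler_sum _ step)).
rewrite -mulr_sumr [X in _ <= X]mulrC ler_wpM2l ?mulr_ge0//.
rewrite big_split /= -mulr_sumr.
(* A split cocycle has exactly [h] lifts and a non-split one none, so this is the total number of
   lifts. *)
have sE : h * \sum_(c : cocycles p H | kills a c) (spl c)%:R =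
    (p ^ #|H|.-1)%:R * p%:R ^+ i.
  rewrite -natrX -natrM -(sum_card_lifts p_pr p_a piC) /h natr_sum mulr_sumr.
  apply: eq_bigr => c _; rewrite /spl.
  case: eqVneq => [->|c_split]; first by rewrite cards0 mulr0.
  by rewrite card_lifts_split// mulr1.
rewrite sE.
have nE : \sum_(c : cocycles p H | kills a c) (h / p%:R ^+ k) <=
    (p ^ #|H|.-1)%:R * p%:R ^+ i / 4.
  rewrite sumr_const -[X in X <= _]mulr_natr.
  have k_ge : (k%:R : R) <= p%:R ^+ k.
    rewrite -natrX ler_nat; apply: ltnW; exact: ltn_expl.
  have hle : h <= (tor p H)%:R * p%:R ^+ i.
    by rewrite -natrX -natrM ler_nat (tor_cover_le piC).
  have nle : (#|kills (p:=p) (H:=H) a|%:R : R) <= #|{: cocycles p H}|%:R.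
    by rewrite ler_nat max_card.
  apply: (@le_trans _ _ (p%:R ^+ i / 4)); last first.
    rewrite ler_wpM2r ?invr_ge0 ?ler0n// ler_peMl ?exprn_ge0 ?ler0n//.
    by rewrite ler1n expn_gt0 prime_gt0.
  rewrite mulrAC ler_pdivrMr ?exprn_gt0//.
  apply: (le_trans (ler_pM h0 (ler0n _ _) hle nle)).
  have -> : (tor p H)%:R * p%:R ^+ i * #|{: cocycles p H}|%:R =
     p%:R ^+ i / 4 * k%:R :> R.
    by rewrite /k /tor_exponent !natrM; field.
  by rewrite ler_wpM2l// divr_ge0 ?exprn_ge0 ?ler0n.
apply: (le_trans (lerD (lexx _) nE)).
by rewrite le_eqVlt; apply/orP; left; apply/eqP; field.
Qed.

End MomentBound.

(** * Convergence of expectations *)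

Section MeanConvergence.
Local Open Scope classical_set_scope.
Context (R : realType) d (T : measurableType d) (P : nat -> probability T R).

(* The means may be infinite for finitely many [n]. *)
Definition mcvg (f : T -> R) (l : R) : Prop :=
  (\forall n \near \oo, (P n).-integrable setT (EFin \o f)) /\
  (fun n => \int[P n]_x f x) @ \oo --> l.

Lemma mcvg_ext f g l : f =1 g -> mcvg f l -> mcvg g l.
Proof. by move=> /funext ->. Qed.

Lemma mcvgD f g l m : mcvg f l -> mcvg g m -> mcvg (fun x => f x + g x) (l + m).
Proof.
move=> [fi fl] [gi gm]; split.
  by near=> n; apply: (@integrableD _ _ _ _ _ _ (EFin \o f) (EFin \o g)) => //;
    near: n.
apply: cvg_trans (cvgD fl gm); apply: near_eq_cvg.
by near=> n; rewrite /= RintegralD//; near: n.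
Unshelve. all: by end_near. Qed.

Lemma mcvgZ f l r : mcvg f l -> mcvg (fun x => r * f x) (r * l).
Proof.
move=> [fi fl]; split.
  by near=> n; apply: (@integrableZl _ _ _ _ _ _ _ (EFin \o f)) => //; near: n.
apply: cvg_trans (cvgMl_tmp (a := r) fl); apply: near_eq_cvg.
by near=> n; rewrite /= RintegralZl//; near: n.
Unshelve. all: by end_near. Qed.

Lemma mcvg0 : mcvg (fun=> 0) 0.
Proof.
split; first by near=> n; exact: integrable0.
by rewrite (_ : (fun n => _) = cst 0); [exact: cvg_cst
  | apply/funext => n; rewrite Rintegral_cst// mul0r].
Unshelve. all: by end_near. Qed.

Lemma mcvg_sum (I : Type) (s : seq I) (A : pred I) (f : I -> T -> R) (l : I -> R) :
  (forall i, A i -> mcvg (f i) (l i)) ->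
  mcvg (fun x => \sum_(i <- s | A i) f i x) (\sum_(i <- s | A i) l i).
Proof.
move=> fl; elim: s => [|i s IH].
  by rewrite big_nil; apply: mcvg_ext mcvg0 => x; rewrite big_nil.
rewrite big_cons; case: ifPn => Ai.
  by apply: mcvg_ext (mcvgD (fl i Ai) IH) => x; rewrite big_cons Ai.
by apply: mcvg_ext IH => x; rewrite big_cons (negbTE Ai).
Qed.

Lemma mcvg_le f g l m : (forall x, f x <= g x) -> mcvg f l -> mcvg g m -> l <= m.
Proof.
move=> fg [fi fl] [gi gm]; apply: (ler_cvg_to fl gm).
by near=> n; apply: le_Rintegral => //; near: n.
Unshelve. all: by end_near. Qed.

Lemma mcvg_lim f l : (forall x, 0 <= f x) -> mcvg f l ->
  (\int[P n]_x (f x)%:E)%E @[n --> \oo] --> l%:E.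
Proof.
move=> f0 [fi fl]; apply/fine_cvgP; split=> //.
by near=> n; apply: integrable_fin_num => //; near: n.
Unshelve. all: by end_near. Qed.

Hypothesis T_discrete : forall A : set T, measurable A.

Lemma lim_mcvg f l : (forall x, 0 <= f x) ->
  (\int[P n]_x (f x)%:E)%E @[n --> \oo] --> l%:E -> mcvg f l.
Proof.
move=> f0 /fine_cvgP[ffin fl]; split=> //; near=> n.
apply/integrableP; split; first by move=> _ Y _; exact: T_discrete.
under eq_integral do rewrite /= ger0_norm//.
by rewrite ltey_eq; apply/orP; left; near: n.
Unshelve. all: by end_near. Qed.

(** This exchanges the limit in [n] with the truncation of the sieve: the error has to be small only
    in limiting mean, not pointwise. *)
Lemma mcvg_approx f :
  (forall e, 0 < e -> exists g h l m, [/\ mcvg g l, mcvg h m, m <= e &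
     forall x, `|f x - g x| <= h x]) ->
  exists l, mcvg f l.
Proof.
move=> fgh; have fi : \forall n \near \oo, (P n).-integrable setT (EFin \o f).
  have [g [h [l [m [[gi _] [hi _] _ fg]]]]] := fgh 1 ltr01.
  near=> n; apply: (@le_integrable _ _ _ _ _ _ _ (fun x => (`|g x| + h x)%:E)).
  - exact: measurableT.
  - by move=> _ Y _; exact: T_discrete.
  - move=> x _ /=; rewrite lee_fin [leRHS]ger0_norm.
      by rewrite -[X in `|X|](subrK (g x)) addrC (le_trans (ler_normD _ _))//
        lerD.
    by rewrite addr_ge0// (le_trans _ (fg x)).
  - apply: (@integrableD _ _ _ _ _ _ (EFin \o (Num.norm \o g)) (EFin \o h)) => //.
      by apply: integrable_norm => //; near: n.
    by near: n.
suff : cvg ((fun n => \int[P n]_x f x) @ \oo) by move=> /cvg_ex[l fl]; exists l.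
apply: cauchy_cvg; apply: cauchy_exP => e e0.
(* The mean of [h] ends up below [m + e / 4 <= e / 2], and that of [g] within [e / 4] of [l]: less
   than [e] in total. *)
have e4 : 0 < e / 4 by rewrite divr_gt0.
have [g [h [l [m [[gi gl] [hi hm] me fg]]]]] := fgh _ e4.
exists l; rewrite /=; near=> n.
have fin : (P n).-integrable setT (EFin \o f) by near: n.
have gin : (P n).-integrable setT (EFin \o g) by near: n.
have hin : (P n).-integrable setT (EFin \o h) by near: n.
have A : `|\int[P n]_x f x - \int[P n]_x g x| <= \int[P n]_x h x.
  have fgi : (P n).-integrable setT (EFin \o (fun x => f x - g x)).
    exact: (@integrableB _ _ _ _ _ _ (EFin \o f) (EFin \o g)).
  rewrite -RintegralB//.
  apply: (le_trans (le_normr_Rintegral measurableT fgi)).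
  by apply: le_Rintegral => //; exact: (integrable_norm fgi).
have B : `|l - \int[P n]_x g x| < e / 4.
  by near: n; move/cvgrPdist_lt : gl => /(_ _ e4).
have C : `|m - \int[P n]_x h x| < e / 4.
  by near: n; move/cvgrPdist_lt : hm => /(_ _ e4).
rewrite /ball /=; move: A B C; move: (\int[P n]_x f x) (\int[P n]_x g x) (\int[P n]_x h x).
move=> u v w; rewrite ler_norml !ltr_norml => /andP[A1 A2] /andP[B1 B2] /andP[C1 C2].
by apply/andP; split; lra.
Unshelve. all: by end_near. Qed.

End MeanConvergence.

(** * Torsion in kernels, injectivity and size *)

Lemma torker_pX p (p_pr : prime p) (X G : finZmodType) (f : X -> G) :
  {morph f : x y / x + y} -> exists d, torker p f = (p ^ d)%N.
Proof.
move=> fD; pose A : {set X} := [set x | (f x == 0) && (x *+ p == 0)].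
have gA : group_set A.
  apply/group_setP; split; first by rewrite inE FinRing.zmod1gE (morphD0 fD) mul0rn !eqxx.
  move=> x y; rewrite !inE FinRing.zmodMgE fD mulrnDl => /andP[/eqP-> /eqP->].
  by move=> /andP[/eqP-> /eqP->]; rewrite !addr0 !eqxx.
pose AG := group gA.
have : (p.-group AG)%g.
  rewrite -pnat_exponent; apply: (@pnat_dvd _ p); last by rewrite pnat_id.
  apply/exponentP => x; rewrite inE FinRing.zmodXgE => /andP[_ /eqP -> //].
by move=> /p_natP[d dE]; exists d.
Qed.

(** [S] lists the primes already sieved. *)
Definition good (S : seq nat) (X G : finZmodType) (f : X -> G) : bool :=
  all (fun q => torker q f == 1%N) S.

(** The new fibre [F_p] has no [q]-torsion, so sieving at [p] leaves the conditions at the earlier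
    primes untouched. *)
Lemma torker_fst p q (E X : finZmodType) (c : cocycle p E)
    (g : {ffun X -> ext c}) : prime p -> prime q -> p != q ->
  g \in surhom X (ext c) ->
  torker q [ffun x => ext_fst (g x)] = torker q g.
Proof.
move=> p_pr q_pr pq /surhomP[gD _]; apply: fintype.eq_card => x; rewrite !inE ffunE.
apply/andP/andP => -[/eqP gx /eqP xq]; split; rewrite ?xq ?eqxx//; last first.
  by rewrite gx.
have : g x *+ q = 0 by rewrite -(morphDMn gD) xq (morphD0 gD).
case: (g x) gx => y u /= ->; rewrite ext_vertMn => -[uq].
suff -> : u = 0 by [].
move/eqP : uq; rewrite -mulr_natr mulf_eq0 => /orP[/eqP //|].
by rewrite -(dvdn_pcharf (pchar_Fp p_pr)) dvdn_prime2// (negPf pq).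
Qed.

Lemma torker1_eq0 p (X G : finZmodType) (f : X -> G) x : f 0 = 0 ->
  torker p f = 1%N -> f x = 0 -> x *+ p = 0 -> x = 0.
Proof.
move=> f0 /eqP/cards1P[y E] fx xp.
have : 0 \in [set x | (f x == 0) && (x *+ p == 0)] by rewrite inE f0 mul0rn !eqxx.
have : x \in [set x | (f x == 0) && (x *+ p == 0)] by rewrite inE fx xp !eqxx.
by rewrite E !inE => /eqP -> /eqP ->.
Qed.

Lemma good_primes_inj a (X G : finZmodType) (f : X -> G) : (0 < a)%N ->
  (forall x : X, x *+ a = 0) -> {morph f : x y / x + y} ->
  good (primes a) f = injectiveb f.
Proof.
move=> a_gt0 aX fD; apply/idP/injectiveP => [/allP fgood|finj]; last first.
  apply/allP => p _; rewrite /torker; apply/eqP.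
  rewrite -(cards1 (0 : X)); apply: fintype.eq_card => x; rewrite !inE.
  apply/andP/eqP => [[/eqP fx _]|->]; last by rewrite (morphD0 fD) mul0rn !eqxx.
  by apply: finj; rewrite fx (morphD0 fD).
(* Induction on an annihilator [m] of [x]: for a prime [p] dividing it, [x *+ (m %/ p)] is
   [p]-torsion in the kernel, hence 0. *)
suff H m (x : X) : (m %| a)%N -> f x = 0 -> x *+ m = 0 -> x = 0.
  move=> x y fxy; apply/eqP; rewrite -subr_eq0; apply/eqP.
  by apply: (H a) => //; rewrite (morphDB fD) fxy subrr.
elim/ltn_ind: m x => m IH x ma fx xm.
have m_gt0 : (0 < m)%N by apply: dvdn_gt0 ma.
have [m1|m1] := leqP m 1.
  by move: xm; rewrite (_ : m = 1%N) ?mulr1n//; lia.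
have p_pr := pdiv_prime m1; set p := pdiv m in p_pr.
have mE : m = (m %/ p * p)%N by rewrite divnK// pdiv_dvd.
apply: (IH (m %/ p)%N) => //.
- by rewrite ltn_Pdiv// prime_gt1.
- by apply: dvdn_trans ma; rewrite [X in (_ %| X)%N]mE dvdn_mulr.
apply: (@torker1_eq0 p _ _ f); rewrite ?(morphD0 fD)//.
- apply/eqP; apply: fgood; rewrite mem_primes p_pr a_gt0.
  by apply: dvdn_trans ma; exact: pdiv_dvd.
- by rewrite (morphDMn fD) fx mul0rn.
- by rewrite -mulrnA -mE.
Qed.

(** Dividing an annihilator of the kernel by a prime costs a factor [B], and [a] crudely bounds the
    number of such divisions. Read contrapositively, a surjection from a large group has a large
    [torker]. *)
Lemma card_le_torker a (X G : finZmodType) (f : X -> G) (B : nat) :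
  (0 < a)%N -> (0 < B)%N ->
  (forall x : X, x *+ a = 0) -> {morph f : x y / x + y} ->
  (forall p, p \in primes a -> torker p f <= B)%N ->
  (#|X| <= #|G| * B ^ a)%N.
Proof.
move=> a_gt0 B_gt0 aX fD fB.
pose A m : {set X} := [set x | (f x == 0) && (x *+ m == 0)].
have AB m : (m %| a)%N -> (#|A m| <= B ^ m)%N.
  elim/ltn_ind: m => m IH ma; have m_gt0 : (0 < m)%N by apply: dvdn_gt0 ma.
  have [m1|m1] := leqP m 1.
    have -> : m = 1%N by lia.
    rewrite (@leq_trans 1)// ?expn_gt0 ?B_gt0//.
    rewrite -[X in (_ <= X)%N](cards1 (0 : X)); apply: subset_leq_card.
    by apply/fintype.subsetP => x; rewrite !inE mulr1n => /andP[].
  have p_pr := pdiv_prime m1; set p := pdiv m in p_pr.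
  have mE : m = (m %/ p * p)%N by rewrite divnK// pdiv_dvd.
  set m' := (m %/ p)%N in mE.
  have m'm : (m' < m)%N by rewrite ltn_Pdiv// prime_gt1.
  have m'a : (m' %| a)%N.
    by apply: dvdn_trans ma; rewrite [X in (_ %| X)%N]mE dvdn_mulr.
  have pa : p \in primes a.
    rewrite mem_primes p_pr a_gt0.
    by apply: dvdn_trans ma; exact: pdiv_dvd.
  apply: (@leq_trans (torker p f * #|A m'|)%N).
    apply: (@card_fibers_le _ _ (fun x : X => x *+ m')) => [x|y _].
      rewrite !inE => /andP[/eqP fx /eqP xm].
      by rewrite (morphDMn fD) fx mul0rn -mulrnA -mE xm !eqxx.
    have [->|[x0]] := set_0Vmem [set x in A m | x *+ m' == y].
      by rewrite cards0.
    rewrite !inE => /andP[/andP[/eqP fx0 _] /eqP x0y].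
    rewrite -[X in (X <= _)%N](card_imset _ (addIr (- x0))).
    apply: subset_leq_card; apply/fintype.subsetP => _ /imsetP[x + ->].
    rewrite !inE => /andP[/andP[/eqP fx _] /eqP xy].
    by rewrite (morphDB fD) fx fx0 subrr mulrnBl xy x0y subrr !eqxx.
  apply: (@leq_trans (B * B ^ m')%N); first by rewrite leq_mul ?fB ?IH.
  by rewrite -expnS leq_pexp2l.
rewrite -[X in (X <= _)%N]cardsT -[#|G|]cardsT.
apply: (@card_fibers_le _ _ f) => [x|y _]; first by rewrite !inE.
apply: leq_trans (AB a (dvdnn a)).
have [->|[x0]] := set_0Vmem [set x in [set: X]%SET | f x == y].
  by rewrite cards0.
rewrite !inE => /eqP fx0.
rewrite -[X in (X <= _)%N](card_imset _ (addIr (- x0))).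
apply: subset_leq_card; apply/fintype.subsetP => _ /imsetP[x + ->].
by rewrite !inE => /eqP fx; rewrite (morphDB fD) fx fx0 subrr aX !eqxx.
Qed.

(** * The sieve applied to random groups of exponent dividing [a] *)

Section Core.
Context (R : realType) d (T : measurableType d) (P : nat -> probability T R).
Hypothesis T_discrete : forall A : set T, measurable A.
Variables (a : nat) (F : T -> finZmodType) (M : finZmodType -> R).
Hypothesis a_gt0 : (0 < a)%N.
Hypothesis aF : forall w (x : F w), x *+ a = 0.
Hypothesis momF : forall G : finZmodType, (forall x : G, x *+ a = 0) ->
  mcvg P (fun w => #|surhom (F w) G|%:R) (M G).
Hypothesis M_ext : forall p (E : finZmodType) (c : cocycle p E), prime p ->
  (p %| a)%N -> (forall z : ext c, z *+ a = 0) ->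
  M (ext c) <= M E * (tor p E)%:R.

Lemma M_ge0 (E : finZmodType) : (forall x : E, x *+ a = 0) -> 0 <= M E.
Proof.
by move=> aE; apply: (mcvg_le _ (mcvg0 P) (momF aE)) => x; exact: ler0n.
Qed.

Definition good_moment (S : seq nat) (G : finZmodType) (w : T) : R :=
  \sum_(g in surhom (F w) G) (good S g)%:R.

Definition good_cvg (S : seq nat) : Prop := forall G : finZmodType,
  (forall x : G, x *+ a = 0) -> exists l, mcvg P (good_moment S G) l.

Lemma good_cvg_nil : good_cvg [::].
Proof.
move=> G aG; exists (M G); apply: mcvg_ext (momF aG) => w.
by rewrite /good_moment /= sumr_const.
Qed.

Section OnePrime.
Variables (S : seq nat) (p : nat) (H : finZmodType).
Hypotheses (p_pr : prime p) (p_a : (p %| a)%N) (p_S : p \notin S).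
Hypothesis S_pr : all prime S.
Hypothesis S_cvg : good_cvg S.

(** Induction on [j]: [sum_sur_ext] trades the factor [D - p^i] for one level of the tower, and
    [sum_moment_ext] keeps the bound. It starts because [tor_excess] is at least 1 on a cover. *)
Lemma cover_moment j i (E : finZmodType) (pi : {additive E -> H}) :
  is_cover p a i pi -> exists l,
  mcvg P (fun w => \sum_(g in surhom (F w) E)
     (good S g)%:R * falling p i j (torker p (pi \o g))%:R) l /\
  l <= M E * tor_excess R p H i E * moment_growth R p i j.
Proof.
have p1 := prime_gt1 p_pr.
have q0 : 0 < p%:R :> R by exact: q_gt0.
elim: j i E pi => [|j IH] i E pi piC.
  have [l lE] := S_cvg (cover_kill piC); exists l; split.
    apply: mcvg_ext lE => w; apply: eq_bigr => g _.
    by rewrite /falling big_ord0 mulr1.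
  have lM : l <= M E.
    apply: (mcvg_le _ lE (momF (cover_kill piC))) => w.
    rewrite /good_moment -sumr_const big_mkcond [leRHS]big_mkcond /=.
    by apply: ler_sum => g _; case: ifP => // _; case: good.
  apply: (le_trans lM); rewrite /moment_growth big_ord0 !mulr1.
  rewrite ler_peMr ?(M_ge0 (cover_kill piC))// exprn_ege1//.
  by rewrite ler_pdivlMr ?exprn_gt0// mul1r -natrX ler_nat (cover_le_tor piC).
pose E' c := ext (pull pi (@to_cocycle p H c)).
pose piE c : {additive E' c -> H} := pi \o @ext_fst p E (pull pi (to_cocycle c)).
have IH' (c : cocycles p H) : exists l, kills a c ->
    mcvg P (fun w => \sum_(g in surhom (F w) (E' c))
     (good S g)%:R * falling p i.+1 j (torker p (piE c \o g))%:R) l /\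
    l <= M (E' c) * tor_excess R p H i.+1 (E' c) * moment_growth R p i.+1 j.
  (* A dummy 0 off the range of the sum, so that the limits can be chosen as one total function. *)
  have [kc|kc] := boolP (kills a c); last by exists 0.
  by have [l lE] := IH _ _ (piE c) (cover_ext p_pr piC kc); exists l.
have [l lE] := boolp.choice IH'.
pose N : R := (p ^ #|H|.-1)%:R.
have N0 : 0 < N by rewrite ltr0n expn_gt0 prime_gt0.
exists (N^-1 * \sum_(c : cocycles p H | kills a c) l c); split.
  have := mcvgZ N^-1 (mcvg_sum (index_enum _) (fun c kc => (lE c kc).1)).
  apply: mcvg_ext => w.
  pose u (g : {ffun F w -> E}) : R :=
    (good S g)%:R * falling p i.+1 j (torker p (pi \o g))%:R.
  have := sum_sur_ext p_pr p_a piC u (@aF w).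
  rewrite -/N => uE.
  transitivity (N^-1 * (N * \sum_(g in surhom (F w) E)
      u g * ((torker p (pi \o g))%:R - (p ^ i)%:R))).
    rewrite -uE; congr (_ * _); apply: eq_bigr => c kc; apply: eq_bigr => g gS.
    rewrite /u; congr ((nat_of_bool _)%:R * falling _ _ _ _%:R).
      apply: eq_in_all => q qS; rewrite (torker_fst _ _ _ gS)//.
        exact: (allP S_pr).
      by apply: contraNneq p_S => ->.
    by apply: fintype.eq_card => x; rewrite !inE /= ffunE.
  rewrite mulKf ?gt_eqF//; apply: eq_bigr => g _.
  by rewrite /u fallingS natrX -mulrA [X in _ * X]mulrC.
rewrite mulrC ler_pdivrMr//.
apply: (le_trans (ler_sum _ (fun c kc => (lE c kc).2))).
rewrite -mulr_suml moment_growthS.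
have := sum_moment_ext p_pr p_a M_ge0 (fun E c => M_ext p_pr p_a (c := c)) piC.
move=> /(ler_wpM2r (moment_growth_ge0 R p i.+1 j)) /le_trans; apply.
by rewrite -/N le_eqVlt; apply/orP; left; apply/eqP; ring.
Qed.

End OnePrime.

Lemma good_cvg_cons (S : seq nat) (p : nat) : prime p -> (p %| a)%N ->
  p \notin S -> all prime S -> good_cvg S -> good_cvg (p :: S).
Proof.
move=> p_pr p_a p_S S_pr S_cvg H aH; have p1 := prime_gt1 p_pr.
have cov := cover_id p aH.
have C0 : 0 <= M H * tor_excess R p H 0 H.
  by rewrite mulr_ge0 ?M_ge0 ?tor_excess_ge0.
apply: (mcvg_approx T_discrete) => e e0.
have [j je] := sieve_error_small p1 C0 e0.
have [l lE] := boolp.choice (fun k =>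
  cover_moment p_pr p_a p_S S_pr S_cvg k cov).
exists (fun w => \sum_(k < j.+1) sieve_weight R p k *
  (\sum_(g in surhom (F w) H) (good S g)%:R * falling p 0 k (torker p g)%:R)).
exists (fun w => `|sieve_weight R p j.+1| * (\sum_(g in surhom (F w) H)
  (good S g)%:R * falling p 0 j.+1 (torker p g)%:R)).
exists (\sum_(k < j.+1) sieve_weight R p k * l k).
exists (`|sieve_weight R p j.+1| * l j.+1); split.
- by apply: mcvg_sum => k _; apply: mcvgZ; exact: (lE k).1.
- by apply: mcvgZ; exact: (lE j.+1).1.
- by apply: le_trans je; rewrite ler_wpM2l// (lE j.+1).2.
move=> w.
have -> : \sum_(k < j.+1) sieve_weight R p k * (\sum_(g in surhom (F w) H)
    (good S g)%:R * falling p 0 k (torker p g)%:R) =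
  \sum_(g in surhom (F w) H) (good S g)%:R *
     \sum_(k < j.+1) sieve_weight R p k * falling p 0 k (torker p g)%:R.
  under eq_bigr do rewrite mulr_sumr.
  rewrite exchange_big; apply: eq_bigr => g _; rewrite mulr_sumr.
  by apply: eq_bigr => k _; rewrite mulrCA.
rewrite /good_moment -sumrB mulr_sumr.
apply: (le_trans (ler_norm_sum _ _ _)); apply: ler_sum => g /surhomP[gD _].
(* [sieve_le] is an inequality at powers of [p] only. *)
have [t tE] := torker_pX p_pr gD.
rewrite /good /= -/(good S g); case: (good S g); last first.
  by rewrite andbF !mul0r subrr normr0 mulr0.
rewrite andbT !mul1r tE natrX.
have := sieve_le R p1 j t; rewrite (_ : (t == 0%N) = (p ^ t == 1)%N)//.
by rewrite -[1%N](expn0 p) eqn_exp2l.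
Qed.

Lemma good_cvg_primes : good_cvg (primes a).
Proof.
have := primes_uniq a; have : {subset primes a <= primes a} by [].
(* The second occurrence stays: it records that the sieved primes divide [a]. *)
move: {1 3 4}(primes a); elim=> [_ _|p S IH pa /= /andP[pS Su]].
  exact: good_cvg_nil.
have := pa p (mem_head _ _); rewrite mem_primes => /and3P[p_pr _ p_a].
apply: good_cvg_cons => //.
  apply/allP => q qS; have := pa q; rewrite inE qS orbT => /(_ isT).
  by rewrite mem_primes => /and3P[].
by apply: IH => // q qS; apply: pa; rewrite inE qS orbT.
Qed.

Lemma iso_moment_cvg (H : finZmodType) : (forall x : H, x *+ a = 0) ->
  exists l, mcvg P
    (fun w => #|[set g in surhom (F w) H | injectiveb g]|%:R) l.
Proof.
move=> aH; have [l lE] := good_cvg_primes aH; exists l.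
apply: mcvg_ext lE => w; rewrite /good_moment.
rewrite -sum1_card natr_sum [LHS]big_mkcond [RHS]big_mkcond /=.
apply: eq_bigr => g _; rewrite [in RHS]inE; case: ifP => //= /surhomP[gD _].
by rewrite (good_primes_inj a_gt0 (@aF w) gD); case: injectiveb.
Qed.

(** Write [D = (D - 1) + 1]: one level of the tower, with no prime sieved, plus the moment of
    [G]. *)
Lemma torker_moment_cvg (p : nat) (G : finZmodType) : p \in primes a ->
  (forall x : G, x *+ a = 0) -> exists l, mcvg P
    (fun w => \sum_(g in surhom (F w) G) (torker p g)%:R) l.
Proof.
rewrite mem_primes => /and3P[p_pr _ p_a] aG.
have [l [lE _]] :=
  cover_moment p_pr p_a (S := [::]) isT isT good_cvg_nil 1 (cover_id p aG).
exists (l + M G); apply: mcvg_ext (mcvgD lE (momF aG)) => w.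
rewrite -sumr_const -big_split /=; apply: eq_bigr => g _.
by rewrite /falling big_ord_recl big_ord0 mulr1 mul1r addn0 expr0 subrK.
Qed.

(** A Markov bound: beyond the size [N], each surjection has some [torker] above [B], so it counts
    at most the sum of these over the primes, divided by [B]. The choice of [B] above [L / e] makes
    the limit at most [e]. *)
Lemma sur_moment_tail (G : finZmodType) (e : R) :
  (forall x : G, x *+ a = 0) -> 0 < e ->
  exists (N : nat) h l, [/\ mcvg P h l, l <= e, forall w, 0 <= h w &
    forall w, (N < #|F w|)%N -> #|surhom (F w) G|%:R <= h w].
Proof.
move=> aG e0.
have /boolp.choice[l lE] (p : nat) : exists l, p \in primes a -> mcvg P
    (fun w => \sum_(g in surhom (F w) G) (torker p g)%:R) l.
  have [pa|pa] := boolP (p \in primes a); last by exists 0.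
  by have [l lE] := torker_moment_cvg pa aG; exists l.
pose L := \sum_(p <- primes a | p \in primes a) l p.
have LE := mcvg_sum (primes a) lE; rewrite -/L in LE.
pose B := (Num.truncn (L / e)).+1.
have BL : L / e < B%:R by rewrite truncnS_gt.
exists (#|G| * B ^ a)%N, (fun w => B%:R^-1 * \sum_(p <- primes a | p \in primes a)
   \sum_(g in surhom (F w) G) (torker p g)%:R), (B%:R^-1 * L); split.
- exact: mcvgZ.
- rewrite ler_pdivrMl ?ltr0n//; move: BL; rewrite ltr_pdivrMr// mulrC => /ltW.
  by rewrite mulrC.
- move=> w; rewrite mulr_ge0 ?invr_ge0 ?ler0n//; apply: sumr_ge0 => p _.
  by apply: sumr_ge0 => g _; exact: ler0n.
move=> w Nw; rewrite ler_pdivlMl ?ltr0n// exchange_big /=.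
rewrite -[X in _ * X]sumr_const mulr_sumr; apply: ler_sum => g /surhomP[gD _].
rewrite mulr1; have /allPn[p pa] : ~~ all (fun p => torker p g <= B)%N (primes a).
  apply/negP => /allP gB; move: Nw; rewrite ltnNge => /negP; apply.
  exact: (card_le_torker a_gt0 _ (@aF w) gD gB).
rewrite -ltnNge => Bp; rewrite (big_rem p)//= pa.
apply: (@le_trans _ _ ((torker p g)%:R)); first by rewrite ler_nat ltnW.
by rewrite lerDl; apply: sumr_ge0 => q _; exact: ler0n.
Qed.

End Core.

(** * Tensor and exterior squares *)

Section Quotients.
Local Open Scope classical_set_scope.
Variables (A : zmodType) (S : set A).

Lemma quot_gen_piB : zmod_morphism (quot_gen_pi S).
Proof. by move=> x y; rewrite /quot_gen_pi raddfB. Qed.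

Lemma quot_gen_piD : {morph quot_gen_pi S : x y / x + y}.
Proof. by move=> x y; rewrite /quot_gen_pi raddfD. Qed.

Lemma quot_gen_pi_surj (q : quot_gen S) : exists x, quot_gen_pi S x = q.
Proof. by exists (repr q); exact: reprK. Qed.

Lemma quot_gen_pi_eq (x y : A) :
  quot_gen_pi S x = quot_gen_pi S y <-> x - y \in gen_subgroup S.
Proof.
rewrite /quot_gen_pi; split=> [/eqP|xy]; first by rewrite -Quotient.idealrBE.
by apply/eqP; rewrite -Quotient.idealrBE.
Qed.

Lemma gen_subgroup_sub (N : {pred A}) (x : A) : zmod_closed N ->
  (forall s, S s -> s \in N) -> x \in gen_subgroup S -> x \in N.
Proof. by move=> Nc SN /asboolP; apply. Qed.

Lemma mem_gen_subgroup (s : A) : S s -> s \in gen_subgroup S.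
Proof. by move=> Ss; apply/asboolP => N _; exact. Qed.

Lemma quot_gen_lift (B : zmodType) (phi : A -> B) : zmod_morphism phi ->
  (forall s, S s -> phi s = 0) ->
  exists psi : quot_gen S -> B,
    zmod_morphism psi /\ forall x, psi (quot_gen_pi S x) = phi x.
Proof.
move=> phiB phiS; exists (fun q => phi (repr q)).
have phi0 : phi 0 = 0 by rewrite -(subrr 0) phiB subrr.
have E x : phi (repr (quot_gen_pi S x)) = phi x.
  apply/eqP; rewrite -subr_eq0 -phiB.
  apply: (@gen_subgroup_sub [pred z | phi z == 0]) => /=.
  - split=> [|u v]; rewrite !inE ?phi0// => /eqP u0 /eqP v0.
    by rewrite phiB u0 v0 subrr.
  - by move=> s /phiS; rewrite inE => ->.
  - by apply/quot_gen_pi_eq; exact: reprK.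
split=> // x y; have [u <-] := quot_gen_pi_surj x.
by have [v <-] := quot_gen_pi_surj y; rewrite -quot_gen_piB !E phiB.
Qed.

End Quotients.

Section TensorLift.
Local Open Scope classical_set_scope.
Variables B C : zmodType.

Lemma pure_tensorDl (b b' : B) (c : C) :
  pure_tensor (b + b') c = pure_tensor b c + pure_tensor b' c.
Proof.
apply/eqP; rewrite -subr_eq0 opprD addrA /pure_tensor -!quot_gen_piB.
rewrite -(subrr (quot_gen_pi (@tensor_rel B C) 0)) -quot_gen_piB subrr.
apply/eqP/quot_gen_pi_eq; rewrite subr0; apply: mem_gen_subgroup.
by left; exists b, b', c.
Qed.

Lemma pure_tensorDr (b : B) (c c' : C) :
  pure_tensor b (c + c') = pure_tensor b c + pure_tensor b c'.
Proof.
apply/eqP; rewrite -subr_eq0 opprD addrA /pure_tensor -!quot_gen_piB.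
rewrite -(subrr (quot_gen_pi (@tensor_rel B C) 0)) -quot_gen_piB subrr.
apply/eqP/quot_gen_pi_eq; rewrite subr0; apply: mem_gen_subgroup.
by right; exists b, c, c'.
Qed.

Lemma tensor_closed_full (N : {pred tensor B C}) : zmod_closed N ->
  (forall b c, pure_tensor b c \in N) -> forall t, t \in N.
Proof.
move=> [N0 NB] Nbc t; have [x <-] := quot_gen_pi_surj t.
have ND u v : u \in N -> v \in N -> u + v \in N.
  by move=> uN vN; rewrite -[v]opprK NB// -sub0r NB.
have NM u (n : int) : u \in N -> u *~ n \in N.
  move=> uN; have NMn k : u *+ k \in N.
    by elim: k => [|k IH]; rewrite ?mulr0n// mulrS ND.
  case: n => [n|n]; first exact: NMn.
  by rewrite NegzE mulrNz -sub0r NB// -pmulrn.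
have piMz (u : {freeg (B * C)%type / int}) (n : int) :
    quot_gen_pi (@tensor_rel B C) (u *~ n) = quot_gen_pi (@tensor_rel B C) u *~ n.
  by rewrite /quot_gen_pi raddfMz.
have piS (I : Type) (s : seq I) (u : I -> {freeg (B * C)%type / int}) :
    quot_gen_pi (@tensor_rel B C) (\sum_(i <- s) u i) =
    \sum_(i <- s) quot_gen_pi (@tensor_rel B C) (u i).
  by rewrite /quot_gen_pi raddf_sum.
rewrite -[x]freeg_sumE piS; elim: (dom x) => [|z s IH].
  by rewrite big_nil.
rewrite big_cons ND// -[coeff z x]intz -freegU_mulz piMz NM//.
by case: z => b c; exact: Nbc.
Qed.

Lemma tensor_lift (M : zmodType) (f : B -> C -> M) :
  (forall b b' c, f (b + b') c = f b c + f b' c) ->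
  (forall b c c', f b (c + c') = f b c + f b c') ->
  exists psi : tensor B C -> M, zmod_morphism psi /\
    forall b c, psi (pure_tensor b c) = f b c.
Proof.
move=> fDl fDr.
(* [fglift] maps into modules over [int]; [ssrint.zmodule] views [M] as one. *)
pose g := fglift (fun z : B * C => (f z.1 z.2 : ssrint.zmodule M)).
have gB : zmod_morphism (g : {freeg (B * C)%type / int} -> M).
  by have := lift_is_additive (fun z : B * C => (f z.1 z.2 : ssrint.zmodule M)).
have gU z : g << z >> = f z.1 z.2 by rewrite /g liftU scale1r.
have [|psi [psiB psiE]] := quot_gen_lift (S := @tensor_rel B C) gB.
  move=> s [[b [b' [c ->]]]|[b [c [c' ->]]]]; rewrite !gB !gU /=.
    by rewrite fDl addrAC addrK subrr.
  by rewrite fDr addrAC addrK subrr.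
by exists psi; split=> // b c; rewrite /pure_tensor psiE gU.
Qed.

End TensorLift.

Section Wedge.
Local Open Scope classical_set_scope.
Variable G : zmodType.

Definition wedge (x y : G) : wedge2 G :=
  quot_gen_pi (range (fun g : G => pure_tensor g g)) (pure_tensor x y).

Lemma wedgeDl x x' y : wedge (x + x') y = wedge x y + wedge x' y.
Proof. by rewrite /wedge pure_tensorDl quot_gen_piD. Qed.

Lemma wedgeDr x y y' : wedge x (y + y') = wedge x y + wedge x y'.
Proof. by rewrite /wedge pure_tensorDr quot_gen_piD. Qed.

Lemma wedge_alt x : wedge x x = 0.
Proof.
rewrite /wedge -[RHS](subrr (quot_gen_pi (range (fun g : G => pure_tensor g g)) 0)).
rewrite -quot_gen_piB subrr; apply/quot_gen_pi_eq; rewrite subr0.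
by apply: mem_gen_subgroup; exists x.
Qed.

Lemma wedge_closed_full (N : {pred wedge2 G}) : zmod_closed N ->
  (forall x y, wedge x y \in N) -> forall t, t \in N.
Proof.
move=> [N0 NB] Nxy t; have [x <-] := quot_gen_pi_surj t.
pose pi := quot_gen_pi (range (fun g : G => pure_tensor g g)).
apply: (@tensor_closed_full _ _ [pred u | pi u \in N]) => [|b c]; last first.
  by rewrite inE Nxy.
split=> [|u v]; rewrite !inE.
  by rewrite -(subrr 0) /pi quot_gen_piB subrr.
by move=> uN vN; rewrite /pi quot_gen_piB NB.
Qed.

Lemma wedge_lift (M : zmodType) (f : G -> G -> M) :
  (forall b b' c, f (b + b') c = f b c + f b' c) ->
  (forall b c c', f b (c + c') = f b c + f b c') ->
  (forall b, f b b = 0) ->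
  exists psi : wedge2 G -> M, zmod_morphism psi /\
    forall b c, psi (wedge b c) = f b c.
Proof.
move=> fDl fDr f0; have [g [gB gE]] := tensor_lift fDl fDr.
have [|psi [psiB psiE]] :=
    quot_gen_lift (S := range (fun g : G => pure_tensor g g)) gB.
  by move=> _ [x _ <-]; rewrite gE f0.
by exists psi; split=> // b c; rewrite /wedge psiE gE.
Qed.

End Wedge.

(** * Finite abelian groups as finite types, and their cardinals *)

Section FinitePacking.
Local Open Scope classical_set_scope.
Variables (M : zmodType) (M_fin : finite_set [set: M]).

(* The proof argument is only a handle for the finite type structure. *)
Definition finz : Type := let _ := M_fin in M.

HB.instance Definition _ := GRing.Zmodule.on finz.

Let e : seq finz := enum_fset (fset_set [set: M]).

Let mem_e x : x \in e.
Proof. by have := in_fset_set M_fin x; rewrite in_setT. Qed.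

Let finz_pickleK : pcancel (fun x : finz => index x e) (onth e).
Proof.
move=> x /=; have xe := mem_e x.
by rewrite onthE (nth_map x) ?index_mem// nth_index.
Qed.

HB.instance Definition _ := Choice_isCountable.Build finz finz_pickleK.

Let finz_enumP : Finite.axiom e.
Proof. by move=> x; rewrite count_uniq_mem ?fset_uniq// mem_e. Qed.

HB.instance Definition _ := fintype.isFinite.Build finz finz_enumP.

End FinitePacking.

Lemma card_im_ker (X Y : finZmodType) (f : X -> Y) :
  {morph f : x y / x + y} ->
  #|X| = (#|f @: [set: X]%SET| * #|[set x | f x == 0%R]|)%N.
Proof.
move=> fD; rewrite -[LHS]cardsT.
apply: (@card_fibers _ _ f) => [x _|y /imsetP[u _ ->]]; first exact: imset_f.
apply: (@card_bij_in _ _ (fun x : X => x - u) (fun x : X => x + u)).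
- by move=> x; rewrite !inE /= => /eqP fx; rewrite (morphDB fD) fx subrr.
- by move=> x; rewrite !inE /= => /eqP fx; rewrite fD fx add0r.
- by move=> x _; rewrite subrK.
- by move=> x _; rewrite addrK.
Qed.

Lemma mulrn_card (X : finZmodType) (x : X) : x *+ #|X| = 0.
Proof.
by have := expg_cardG (finset.in_setT x); rewrite FinRing.zmodXgE cardsT.
Qed.

Lemma ncardE (T : choiceType) (U : finType) (A : set T) (B : {set U})
    (f : U -> T) :
  (forall u, u \in B -> A (f u)) ->
  (forall t, A t -> exists2 u, u \in B & f u = t) ->
  {in B &, injective f} -> ncard A = #|B|.
Proof.
move=> fA Af finj; rewrite /ncard.
have -> : fset_set A = [fset f u | u in enum B]%fset.
  have -> : A = [set` [fset f u | u in enum B]%fset]%classic.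
    apply/seteqP; split=> t /=.
      move=> /Af[u uB <-]; apply/imfsetP; exists u => //=.
      by rewrite mem_enum.
    by move=> /imfsetP[u /=]; rewrite mem_enum => uB ->; exact: fA.
  by rewrite set_fsetK.
rewrite card_in_imfset /=; last first.
  by move=> u v; rewrite !mem_enum; exact: finj.
by rewrite undup_id ?enum_uniq// -cardE.
Qed.

Lemma ncard_finz (M : zmodType) (M_fin : finite_set [set: M]%classic) :
  ncard [set: M]%classic = #|{: finz M_fin}|.
Proof.
rewrite -[RHS]cardsT; apply: (@ncardE _ _ _ _ (fun x : finz M_fin => x : M)).
- by [].
- by move=> t _; exists t; rewrite ?inE.
- by [].
Qed.

Lemma finite_torsion_gen (M : zmodType) (I : finType) (g : I -> M) (m : nat) :
  (0 < m)%N -> (forall i, g i *+ m = 0) ->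
  (forall N : {pred M}, zmod_closed N -> (forall i, g i \in N) ->
     forall x, x \in N) -> finite_set [set: M]%classic.
Proof.
case: m => // m _ gm gfull.
pose s (c : {ffun I -> 'I_m.+1}) := \sum_i g i *+ c i.
have gmod i n : g i *+ (n %% m.+1) = g i *+ n.
  by rewrite [in RHS](divn_eq n m.+1) mulrnDr mulnC mulrnA gm mul0rn add0r.
have gB i (k l : 'I_m.+1) : g i *+ (k - l)%R = g i *+ k - g i *+ l.
  apply/eqP; rewrite eq_sym subr_eq -mulrnDr -[X in _ == X]gmod.
  suff -> : (((k - l)%R + l) %% m.+1)%N = k by [].
  exact: (congr1 val (subrK l k)).
have sfull x : x \in [pred x | [exists c, x == s c]].
  apply: gfull => [|i]; last first.
    rewrite inE; apply/existsP.
    (* [inZp] also covers coefficients modulo 1, where 1 reduces to 0. *)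
    exists [ffun j => if j == i then inZp 1 else 0].
    rewrite /s (bigD1 i)//= ffunE eqxx gmod mulr1n big1 ?addr0// => j ji.
    by rewrite ffunE (negPf ji) mulr0n.
  split=> [|x' y]; rewrite !inE.
    apply/existsP; exists [ffun=> 0]; rewrite /s big1// => i _.
    by rewrite ffunE mulr0n.
  move=> /existsP[c /eqP ->] /existsP[c' /eqP ->]; apply/existsP.
  exists [ffun i => c i - c' i]; rewrite /s -sumrB; apply/eqP/eq_bigr => i _.
  by rewrite ffunE gB.
apply: (@sub_finite_set _ _ (s @` setT)%classic) => [x _|].
  by have := sfull x; rewrite inE => /existsP[c /eqP ->]; exists c.
exact: finite_image.
Qed.

Lemma wedgeMnl (G : zmodType) (x y : G) n : wedge (x *+ n) y = wedge x y *+ n.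
Proof. exact: (morphDMn (fun x x' => wedgeDl x x' y)). Qed.

Lemma wedgeMnr (G : zmodType) (x y : G) n : wedge x (y *+ n) = wedge x y *+ n.
Proof. exact: (morphDMn (fun y y' => wedgeDr x y y')). Qed.

Lemma wedgeC (G : zmodType) (x y : G) : wedge x y = - wedge y x.
Proof.
apply/eqP; rewrite -addr_eq0; apply/eqP; have := wedge_alt (x + y).
by rewrite wedgeDl !wedgeDr !wedge_alt add0r addr0.
Qed.

Lemma wedge2_finite (G : finZmodType) : finite_set [set: wedge2 G]%classic.
Proof.
apply: (@finite_torsion_gen _ _ (fun z : G * G => wedge z.1 z.2) #|G|).
- by apply/card_gt0P; exists 0.
- by move=> z; rewrite -wedgeMnl mulrn_card -(mulr0n 0) wedgeMnl mulr0n.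
- move=> N Nc NG; apply: wedge_closed_full => // x y.
  exact: (NG (x, y)).
Qed.

(** * The exterior square under one extension step *)

Section WedgeStep.
Variables (p : nat) (E' E : finZmodType) (pi : {additive E' -> E}) (v : E').
Hypotheses (pi_surj : forall e, exists x, pi x = e).
Hypothesis v_p : v *+ p = 0.
Hypothesis ker_pi : forall x, pi x = 0 -> exists k : nat, x = v *+ k.

(** The kernel of the map between exterior squares consists of the wedges with [v]. Because
    [wedge v v = 0] and [v *+ p = 0], these form a quotient of [E/pE], whose order is [tor p E]. *)
Lemma ncard_wedge2_step :
  (ncard [set: wedge2 E']%classic <= ncard [set: wedge2 E]%classic * tor p E)%N.
Proof.
rewrite (ncard_finz (wedge2_finite E')) (ncard_finz (wedge2_finite E)).
pose W' : finZmodType := finz (wedge2_finite E').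
pose W : finZmodType := finz (wedge2_finite E).
change (#|W'| <= #|W| * tor p E)%N.
pose w : E' -> E' -> W' := @wedge E'.
have [s sK] := boolp.choice pi_surj.
have pi_eq x y : pi x = pi y -> exists k : nat, x = y + v *+ k.
  move=> xy; have [|k E1] := ker_pi (x := x - y); first by rewrite raddfB xy subrr.
  by exists k; rewrite -E1 addrC subrK.
have wv x y : pi x = pi y -> w v x = w v y.
  move=> /pi_eq[k ->].
  by rewrite /w wedgeDr wedgeMnr wedge_alt mul0rn addr0.
pose f (e : E) : W' := w v (s e).
have fE x : f (pi x) = w v x by apply: wv; rewrite sK.
have fD : {morph f : x y / x + y}.
  by move=> x y; rewrite -(sK x) -(sK y) -raddfD !fE; exact: wedgeDr.
pose Z : {set W'} := f @: [set: E]%SET.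
have Zf e : f e \in Z by exact: imset_f.
have Zle : (#|Z| <= tor p E)%N.
  have := card_im_ker fD; rewrite -/Z.
  have := @card_im_ker E E (fun x => x *+ p) (fun x y => mulrnDl p x y).
  rewrite -/(tor p E) => -> Ecard.
  have pE : (#|[set x *+ p | x in [set: E]%SET]| <= #|[set x | f x == 0%R]|)%N.
    apply: subset_leq_card; apply/fintype.subsetP => _ /imsetP[x _ ->].
    rewrite inE (morphDMn fD) -(sK x) fE -wedgeMnl v_p.
    by rewrite -(mulr0n 0) wedgeMnl mulr0n.
  have K0 : (0 < #|[set x : E | f x == 0%R]|)%N.
    by apply/card_gt0P; exists 0; rewrite inE (morphD0 fD).
  rewrite -(leq_pmul2r K0) -Ecard mulnC leq_mul//.
(* modulo the image of [v] the wedge of lifts is well defined on [E] *)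
pose Zs : set (wedge2 E') := [set z | (z : W') \in Z]%classic.
pose pq := quot_gen_pi Zs.
have ZsP z : z \in gen_subgroup Zs -> (z : W') \in Z.
  apply: (gen_subgroup_sub (N := [pred z : wedge2 E' | (z : W') \in Z])) => //.
  split=> [|x y]; rewrite !inE; first by rewrite -(morphD0 fD) Zf.
  by move=> /imsetP[x' _ ->] /imsetP[y' _ ->]; rewrite -(morphDB fD) Zf.
have pqf e : pq (f e) = 0.
  rewrite -(subrr (pq 0)) -quot_gen_piB subrr; apply/quot_gen_pi_eq.
  by rewrite subr0; apply: mem_gen_subgroup; exact: Zf.
have pqD x y : pq (x + y) = pq x + pq y by exact: quot_gen_piD.
have pqk x k : pq (wedge (v *+ k) x) = 0.
  by rewrite wedgeMnl -wedgeMnr -[wedge v _]/(w v _) -fE pqf.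
have pql x x' y : pi x = pi x' -> pq (wedge x y) = pq (wedge x' y).
  by move=> /pi_eq[k ->]; rewrite wedgeDl pqD pqk addr0.
have pqC x y : pq (wedge x y) = - pq (wedge y x).
  by rewrite wedgeC (morphDN pqD).
have pqr x y y' : pi y = pi y' -> pq (wedge x y) = pq (wedge x y').
  by move=> yy; rewrite pqC (pql _ _ _ yy) -pqC.
have [|||psi [psiB psiE]] := wedge_lift
    (f := fun x y => pq (wedge (s x) (s y))).
- move=> x x' y; rewrite (pql _ (s x + s x')) ?raddfD ?sK//.
  by rewrite wedgeDl pqD.
- move=> x y y'; rewrite (pqr _ _ (s y + s y')) ?raddfD ?sK//.
  by rewrite wedgeDr pqD.
- by move=> x; rewrite wedge_alt (morphD0 pqD).
have psiS t : exists u, psi u = pq t.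
  suff : t \in [pred t | `[< exists u, psi u = pq t >]].
    by rewrite inE.
  apply: wedge_closed_full => [|x y].
    split=> [|x y]; rewrite !inE.
      exists 0.
      by rewrite (morphD0 pqD) -[X in psi X](subrr 0) psiB subrr.
    move=> [u uE] [u' uE']; exists (u - u').
    by rewrite psiB uE uE' -quot_gen_piB.
  rewrite inE; exists (wedge (pi x) (pi y)).
  by rewrite psiE (pql _ x) ?sK// (pqr _ _ y) ?sK.
have [r rE] := boolp.choice (fun u => quot_gen_pi_surj (psi u)).
apply: leq_trans (leq_mul (leqnn _) Zle).
rewrite -(cardsT W) -cardsX -(cardsT W').
(* Every element is a chosen representative of some [psi u] plus an element of [Z], so pairs in [W]
   times [Z] cover everything. *)
pose h (z : W * W') : W' := (r z.1 : W') + z.2.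
apply: leq_trans (leq_imset_card h _); apply: subset_leq_card.
apply/fintype.subsetP => t _; have [u uE] := psiS t.
apply/imsetP; exists (u, (t - r u : W')); last by rewrite /h /= addrC subrK.
rewrite finset.in_setX inE /=; apply: ZsP; apply/quot_gen_pi_eq.
by rewrite rE uE.
Qed.

End WedgeStep.

Lemma zmod_morphismD (X Y : zmodType) (f : X -> Y) : zmod_morphism f ->
  {morph f : x y / x + y}.
Proof.
move=> fB; have f0 : f 0 = 0 by rewrite -(subrr 0) fB subrr.
by move=> x y; rewrite -[in LHS](opprK y) fB -(sub0r y) fB f0 sub0r opprK.
Qed.

Lemma morphDMz (X Y : zmodType) (f : X -> Y) (x : X) (n : int) :
  {morph f : x y / x + y} -> f (x *~ n) = f x *~ n.
Proof.
move=> fD; case: n => n; first exact: morphDMn.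
by rewrite NegzE !mulrNz -!pmulrn (morphDN fD) (morphDMn fD).
Qed.

(** * Reduction modulo [a] and its universal property *)

Section TensorIntMod.
Variable a : nat.
Variable X : zmodType.

Definition int_mod1 : int_mod a := quot_gen_pi [set a%:Z]%classic 1.

Lemma int_mod_gen (c : int_mod a) : exists k : int, c = int_mod1 *~ k.
Proof.
have [k <-] := quot_gen_pi_surj c; exists k.
rewrite /int_mod1 -(morphDMz _ _ (@quot_gen_piD _ _)) intz //.
Qed.

Lemma int_mod1_a : int_mod1 *+ a = 0.
Proof.
rewrite -(morphDMn (@quot_gen_piD _ _)) -[RHS](morphD0 (@quot_gen_piD _ [set a%:Z]%classic)).
apply/quot_gen_pi_eq; rewrite subr0; apply: mem_gen_subgroup => /=.
exact: natz.
Qed.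

Definition to_tensor (x : X) : tensor X (int_mod a) := pure_tensor x int_mod1.

Lemma to_tensorD : {morph to_tensor : x y / x + y}.
Proof. by move=> x y; exact: pure_tensorDl. Qed.

Lemma pure_tensor_int_mod x (k : int) :
  pure_tensor x (int_mod1 *~ k) = to_tensor x *~ k.
Proof. by rewrite (morphDMz _ _ (pure_tensorDr x)). Qed.

Lemma to_tensor_surj t : exists x, to_tensor x = t.
Proof.
suff : t \in [pred t | `[< exists x, to_tensor x = t >]] by rewrite inE.
apply: tensor_closed_full => [|x c].
  split=> [|u v]; rewrite !inE.
    by exists 0; exact: (morphD0 to_tensorD).
  by move=> [x <-] [y <-]; exists (x - y); rewrite (morphDB to_tensorD).
rewrite inE; have [k ->] := int_mod_gen c; exists (x *~ k).
by rewrite pure_tensor_int_mod (morphDMz _ _ to_tensorD).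
Qed.

Lemma tensor_kill (t : tensor X (int_mod a)) : t *+ a = 0.
Proof.
have [x <-] := to_tensor_surj t.
by rewrite -(morphDMn (pure_tensorDr x)) int_mod1_a (morphD0 (pure_tensorDr x)).
Qed.

Lemma tensor_factor (G : zmodType) (f : X -> G) : (forall g : G, g *+ a = 0) ->
  zmod_morphism f -> exists g : tensor X (int_mod a) -> G,
    zmod_morphism g /\ forall x, g (to_tensor x) = f x.
Proof.
move=> aG /zmod_morphismD fD.
have psi_ex (y : G) : exists psi : int_mod a -> G, zmod_morphism psi /\
    forall k, psi (quot_gen_pi [set a%:Z]%classic k) = y *~ k.
  apply: quot_gen_lift => [k l|_ ->]; first by rewrite mulrzBr.
  exact: aG.
have [psi psiP] := boolp.choice psi_ex.
have psiE y k : psi y (int_mod1 *~ k) = y *~ k.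
  have [psiB pE] := psiP y.
  by rewrite (morphDMz _ _ (zmod_morphismD psiB)) pE.
have [|| g [gB gE]] := @tensor_lift X (int_mod a) G (fun x c => psi (f x) c).
- move=> x y c; have [k ->] := int_mod_gen c.
  by rewrite !psiE fD mulrzDl.
- by move=> x c c'; have [psiB _] := psiP (f x); exact: zmod_morphismD.
by exists g; split=> // x; rewrite gE -[int_mod1]mulr1z psiE mulr1z.
Qed.

End TensorIntMod.

Lemma fgab_tensor_finite (a : nat) (X : fgab) : (0 < a)%N ->
  finite_set [set: tensor X (int_mod a)]%classic.
Proof.
move=> a_gt0; case E : (repr X) => [r S]; rewrite /fgab_group E.
pose pi := quot_gen_pi S.
apply: (@finite_torsion_gen _ _ (fun i : 'I_r =>
  to_tensor a (pi (delta_mx 0 i) : fgpres_group (FGPres S))) a) => //.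
  by move=> i; exact: tensor_kill.
move=> N [N0 NB] Nd t; have [x <-] := to_tensor_surj t.
have [v <-] := quot_gen_pi_surj x.
pose h (v : 'rV[int]_r) := to_tensor a (pi v : fgpres_group (FGPres S)).
have hD : {morph h : u v / u + v}.
  by move=> u u'; rewrite /h /pi quot_gen_piD to_tensorD.
have ND u u' : u \in N -> u' \in N -> u + u' \in N.
  by move=> uN vN; rewrite -[u']opprK NB// -sub0r NB.
have NM u (n : int) : u \in N -> u *~ n \in N.
  move=> uN; have NMn k : u *+ k \in N.
    by elim: k => [|k IH]; rewrite ?mulr0n// mulrS ND.
  case: n => [n|n]; first exact: NMn.
  by rewrite NegzE mulrNz -sub0r NB// -pmulrn.
change (h v \in N); rewrite [v]matrix_sum_delta big_ord1.
rewrite (big_morph h hD (morphD0 hD)).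
elim/big_ind: _ => // i _.
have -> : v 0 i *: delta_mx 0 i = (delta_mx 0 i : 'rV[int]_r) *~ v 0 i.
  by rewrite -scaler_int intz.
by rewrite (morphDMz _ _ hD) NM//; exact: Nd.
Qed.

Section CountSur.

(** Serves twice: with [tau] the reduction modulo [a], and with [tau] an isomorphism. *)
Lemma nSur_factor (X G0 : zmodType) (Q G : finZmodType) (tau : X -> Q)
    (i : G -> G0) :
  {morph tau : x y / x + y} -> (forall q, exists x, tau x = q) ->
  zmod_morphism i -> bijective i ->
  (forall f : X -> G0, zmod_morphism f -> exists g : Q -> G0,
     zmod_morphism g /\ forall x, g (tau x) = f x) ->
  nSur X G0 = #|surhom Q G|.
Proof.
move=> tauD tau_surj iB [j iK jK] fact.
have iD := zmod_morphismD iB.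
apply: (@ncardE _ _ _ _ (fun (h : {ffun Q -> G}) (x : X) => i (h (tau x)))).
- move=> h /surhomP[hD hS]; split.
    by move=> x y; rewrite (morphDB tauD) (morphDB hD) iB.
  apply/seteqP; split=> // y _; have [q qE] := hS (j y).
  by have [x xE] := tau_surj q; exists x => //; rewrite xE qE jK.
- move=> f [fB fS]; have [g [gB gE]] := fact f fB.
  have gD := zmod_morphismD gB.
  exists [ffun q => j (g q)]; last first.
    by apply/funext => x; rewrite ffunE jK gE.
  apply/surhomP; split.
    by move=> x y; rewrite !ffunE gD; apply: (can_inj iK); rewrite iD !jK.
  move=> y; have : range f (i y) by rewrite fS.
  by move=> [x _ fx]; exists (tau x); rewrite ffunE gE fx iK.
- move=> h h' _ _ hh; apply/ffunP => q.
  have [x <-] := tau_surj q; apply: (can_inj iK).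
  exact: (congr1 (fun f => f x) hh).
Qed.

End CountSur.

(** * Isomorphism classes of finite groups *)

Section FiniteGroups.
Local Open Scope classical_set_scope.

Lemma zmod_iso_inv (B C : zmodType) : zmod_iso B C ->
  exists (f : B -> C) (g : C -> B), [/\ {morph f : x y / x + y},
    {morph g : x y / x + y}, cancel f g & cancel g f].
Proof.
move=> [f [fB [g fK gK]]]; have fD := zmod_morphismD fB.
exists f, g; split=> // x y; apply: (can_inj fK); rewrite fD !gK //.
Qed.

Lemma zmod_isoI (B C : zmodType) (f : B -> C) (g : C -> B) :
  {morph f : x y / x + y} -> cancel f g -> cancel g f -> zmod_iso B C.
Proof.
move=> fD fK gK; exists f; split; last by exists g.
by move=> x y; rewrite (morphDB fD).
Qed.

Lemma zmod_iso_finite (B C : zmodType) : zmod_iso B C ->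
  finite_set [set: B] -> finite_set [set: C].
Proof.
move=> /zmod_iso_inv[f [g [_ _ _ gK]]] Bfin.
apply: (sub_finite_set (B := f @` setT)); last exact: finite_image.
by move=> y _; exists (g y).
Qed.

Lemma zmod_iso_kill (B C : zmodType) a : zmod_iso B C ->
  (forall x : B, x *+ a = 0) -> (forall x : C, x *+ a = 0).
Proof.
move=> /zmod_iso_inv[f [g [fD _ _ gK]]] aB x.
by rewrite -(gK x) -(morphDMn fD) aB (morphD0 fD).
Qed.

Lemma finz_iso (M : zmodType) (M_fin : finite_set [set: M]) :
  zmod_iso (finz M_fin) M.
Proof. exact: zmod_iso_refl. Qed.

Lemma finite_exp_dvdP (a : nat) (G : fgab) : (0 < a)%N ->
  finite_exp_dvd a G <->
  finite_set [set: G] /\ (forall g : G, g *+ a = 0).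
Proof.
move=> a_gt0; split=> -[Gfin].
  move=> [e [e_gt0 eG _] /dvdnP[k ->]]; split=> // g.
  by rewrite mulnC mulrnA eG mul0rn.
move=> aG; split=> //.
pose Q k := (0 < k)%N && `[< forall g : G, g *+ k = 0 >].
have exQ : exists k, Q k by exists a; rewrite /Q a_gt0; apply/asboolP.
case: (ex_minnP exQ) => e /andP[e_gt0 /asboolP eG] emin.
exists e; first split=> // k k_gt0 kG.
  by apply: emin; rewrite /Q k_gt0; apply/asboolP.
(* A nonzero remainder of [a] by [e] would be a smaller annihilator. *)
rewrite /dvdn; apply/negPn/negP; rewrite -lt0n => r_gt0.
have : (e <= a %% e)%N.
  apply: emin; rewrite /Q r_gt0; apply/asboolP => g.
  have := aG g; rewrite [in LHS](divn_eq a e) mulrnDr mulnC mulrnA eG mul0rn.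
  by rewrite add0r.
by rewrite leqNgt ltn_mod e_gt0.
Qed.

Lemma fgab_of_finz (G : finZmodType) : exists H : fgab, zmod_iso H G.
Proof.
apply: (@fgab_of_generators G #|G| (fun i => enum_val i)) => x.
exists (delta_mx 0 (enum_rank x)).
rewrite (bigD1 (enum_rank x))//= mxE !eqxx enum_rankK mulr1z.
rewrite big1 ?addr0// => i ix.
by rewrite mxE (negPf ix) andbF mulr0z.
Qed.

(** Such a group is recovered from an addition table on a subset of ['I_N.+1], and there are
    finitely many of these. *)
Lemma finite_fgab_le (N : nat) : finite_set
  [set H : fgab | finite_set [set: H] /\ (ncard [set: H] <= N)%N].
Proof.
set S := [set H : fgab | _].
pose K := 'I_N.+1.
pose codes (H : fgab) (c : {ffun K * K -> K} * {set K}) := exists e : H -> K,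
  [/\ injective e, forall x y, c.1 (e x, e y) = e (x + y) &
      forall k, k \in c.2 <-> exists x, e x = k].
have /boolp.choice[c cP] (H : fgab) : exists c, S H -> codes H c.
  have [[Hfin HN]|nS] := pselect (S H); last by exists ([ffun=> ord0], finset.set0).
  pose G : finZmodType := finz Hfin.
  have GN : (#|G| < N.+1)%N by rewrite ltnS -(ncard_finz Hfin).
  pose e (x : G) : K := widen_ord (ltnW GN) (enum_rank x).
  have einj : injective e.
    by move=> x y /(congr1 val)/= /val_inj /enum_rank_inj.
  pose e' (k : K) : G := odflt 0 [pick x | e x == k].
  have eK : cancel e e'.
    move=> x; rewrite /e'; case: pickP => [y /eqP/einj //|/(_ x)].
    by rewrite eqxx.
  exists ([ffun z => e (e' z.1 + e' z.2)], e @: [set: G]%SET) => _.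
  exists e; split=> //= [x y|k]; first by rewrite ffunE /= !eK.
  split=> [/imsetP[x _ ->]|[x <-]]; first by exists x.
  by apply: imset_f; rewrite inE.
suff cinj : {in S &, injective c}.
  have := inj_card_eq cinj; rewrite card_eq_le => /andP[_ SI].
  exact: card_le_finite SI finite_finset.
move=> H H' /set_mem HS /set_mem HS' cE; apply: fgab_group_inj.
have [e [einj eD eI]] := cP H HS.
have [e' [einj' eD' eI']] := cP H' HS'.
have /boolp.choice[f fE] (x : H) : exists y : H', e' y = e x.
  by apply/eI'; rewrite -cE; apply/eI; exists x.
have /boolp.choice[g gE] (y : H') : exists x : H, e x = e' y.
  by apply/eI; rewrite cE; apply/eI'; exists y.
apply: (@zmod_isoI _ _ f g) => [x y|x|y].
- by apply: einj'; rewrite fE -eD' -cE !fE eD.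
- by apply: einj; rewrite gE fE.
- by apply: einj'; rewrite fE gE.
Qed.

Lemma isosP (Q G : finZmodType) (g : {ffun Q -> G}) :
  reflect [/\ {morph g : x y / x + y}, forall y, exists x, g x = y & injective g]
    (g \in [set g in surhom Q G | injectiveb g]%SET).
Proof.
rewrite finset.in_set; apply: (iffP andP).
  by move=> [/surhomP[gD gS] /injectiveP gI].
by move=> [gD gS gI]; split; [exact/surhomP | exact/injectiveP].
Qed.

(** Isomorphisms from [Q] to [G] form a torsor under the automorphisms of [G], or there are none.
    Dividing by the number of automorphisms turns the sieved moment into a probability. *)
Lemma card_isos (Q G : finZmodType) :
  #|[set g in surhom Q G | injectiveb g]%SET| =
  (`[< zmod_iso Q G >] * #|[set g in surhom G G | injectiveb g]%SET|)%N.
Proof.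
have [/zmod_iso_inv[f [f' [fD fD' fK fK']]]|niso] := asboolP; last first.
  rewrite mul0n; apply/eqP; rewrite cards_eq0 -finset.subset0.
  apply/fintype.subsetP => g /isosP[gD gS gI].
  case: niso; have [g' gK'] := boolp.choice gS.
  by apply: (@zmod_isoI _ _ g g') => // x; apply: gI; rewrite gK'.
rewrite mul1n; apply: (@card_bij_in _ _
  (fun g : {ffun Q -> G} => [ffun x => g (f' x)] : {ffun G -> G})
  (fun g : {ffun G -> G} => [ffun x => g (f x)] : {ffun Q -> G})).
- move=> g /isosP[gD gS gI].
  apply/isosP; split=> [x y|y|x y]; last 1 first.
  - by rewrite !ffunE => /gI/(can_inj fK').
  -  by rewrite !ffunE fD' gD.
  - by have [x <-] := gS y; exists (f x); rewrite ffunE fK.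
- move=> g /isosP[gD gS gI].
  apply/isosP; split=> [x y|y|x y]; last 1 first.
  - by rewrite !ffunE => /gI/(can_inj fK).
  -  by rewrite !ffunE fD gD.
  - by have [x <-] := gS y; exists (f' x); rewrite ffunE fK'.
- by move=> g _; apply/ffunP => x; rewrite !ffunE fK.
- by move=> g _; apply/ffunP => x; rewrite !ffunE fK'.
Qed.

Lemma card_autos_gt0 (G : finZmodType) :
  (0 < #|[set g in surhom G G | injectiveb g]%SET|)%N.
Proof.
apply/card_gt0P; exists [ffun x => x]; apply/isosP; split=> [x y|y|x y].
- by rewrite !ffunE.
- by exists y; rewrite ffunE.
- by rewrite !ffunE.
Qed.

End FiniteGroups.

(** * Limit laws *)

Lemma sum_indic_le (R : realType) (T : Type) (I : eqType) (s : seq I)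
    (A : I -> set T) (c : I -> R) (N : R) (x : T) : uniq s -> 0 <= N ->
  (forall i j, A i x -> A j x -> i = j) -> (forall i, A i x -> c i = N) ->
  \sum_(i <- s) c i * \1_(A i) x <= N.
Proof.
move=> + N0 Ainj cN; elim: s => [_|i s IH]; first by rewrite big_nil.
rewrite cons_uniq => /andP[is_ us].
rewrite big_cons; have [Ai|nAi] := pselect (A i x); last first.
  by rewrite indicE memNset// mulr0 add0r IH.
rewrite indicE mem_set// mulr1 big_seq big1 ?addr0 ?cN// => j js.
rewrite indicE memNset ?mulr0// => Aj.
by move: is_; rewrite (Ainj _ _ Ai Aj) js.
Qed.

Lemma le_sum_indic (R : realType) (T : Type) (I : eqType) (s : seq I)
    (A : I -> set T) (c : I -> R) (x : T) (i : I) : i \in s ->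
  (forall j, 0 <= c j) -> A i x -> c i <= \sum_(j <- s) c j * \1_(A j) x.
Proof.
move=> is_ c0 Ai; rewrite (big_rem i)// indicE mem_set// mulr1 lerDl.
by apply: sumr_ge0 => j _; rewrite mulr_ge0// indicE.
Qed.

Section Laws.
Local Open Scope classical_set_scope.
Context (R : realType) (a : nat) (a_gt0 : (0 < a)%N).

Definition reduction (X : fgab) : finZmodType := finz (fgab_tensor_finite X a_gt0).

Lemma reduction_kill (X : fgab) (x : reduction X) : x *+ a = 0.
Proof. exact: tensor_kill. Qed.

Definition fgab_of (G : finZmodType) : fgab := projT1 (cid (fgab_of_finz G)).

Lemma fgab_of_iso (G : finZmodType) : zmod_iso (fgab_of G) G.
Proof. exact: projT2 (cid (fgab_of_finz G)). Qed.

(** Taken at a representative in [fgab], where the hypothesis on moments gives the limit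
    verbatim. *)
Definition wedge_moment (G : finZmodType) : R :=
  (ncard [set: wedge2 (fgab_of G)])%:R.

Lemma nSur_reduction (X : fgab) (G0 : zmodType) (G : finZmodType) :
  zmod_iso G G0 -> (forall x : G0, x *+ a = 0) ->
  nSur X G0 = #|surhom (reduction X) G|.
Proof.
move=> [i [iB ibij]] aG0.
have fac := @nSur_factor X G0 (reduction X) G (@to_tensor a X) i
  (@to_tensorD a X).
apply: fac => //.
- exact: to_tensor_surj.
- by move=> f; exact: tensor_factor.
Qed.

Lemma nSur_iso (X G0 : zmodType) (Q G : finZmodType) :
  zmod_iso X Q -> zmod_iso G G0 -> nSur X G0 = #|surhom Q G|.
Proof.
move=> /zmod_iso_inv[f [g [fD gD fK gK]]] [i [iB ibij]].
have fac := @nSur_factor X G0 Q G f i fD.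
apply: fac => // [q|h hB]; first by exists (g q).
exists (h \o g); split=> [x y|x]; last by rewrite /= fK.
by rewrite /= (morphDB gD) hB.
Qed.

Lemma tor_iso p (E E' : finZmodType) : zmod_iso E E' -> tor p E = tor p E'.
Proof.
move=> /zmod_iso_inv[f [g [fD gD fK gK]]].
apply: (@card_bij_in _ _ f g) => x; rewrite ?inE => // /eqP xp.
- by rewrite -(morphDMn fD) xp (morphD0 fD).
- by rewrite -(morphDMn gD) xp (morphD0 gD).
Qed.

Lemma wedge_moment_ext p (E : finZmodType) (c : cocycle p E) : prime p ->
  wedge_moment (ext c) <= wedge_moment E * (tor p E)%:R.
Proof.
move=> p_pr; rewrite -natrM ler_nat.
set A' := fgab_of (ext c); set A := fgab_of E.
have isoA' : zmod_iso A' (ext c) by exact: fgab_of_iso.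
have isoA : zmod_iso A E by exact: fgab_of_iso.
have finA' : finite_set [set: A'].
  apply: (zmod_iso_finite (zmod_iso_sym isoA')); exact: finite_finset.
have finA : finite_set [set: A].
  apply: (zmod_iso_finite (zmod_iso_sym isoA)); exact: finite_finset.
rewrite -(@tor_iso p (finz finA) E)//.
have [f [g [fD gD fK gK]]] := zmod_iso_inv isoA'.
have [f0 [g0 [fD0 gD0 fK0 gK0]]] := zmod_iso_inv isoA.
pose pi0 (x : finz finA') : finz finA := g0 (f x).1.
have piB : zmod_morphism pi0.
  move=> x y; rewrite /pi0 -(morphDB gD0) (morphDB fD).
  by congr g0.
have [pi piE] : exists pi : {additive finz finA' -> finz finA},
    forall x, pi x = g0 (f x).1.
  pose pi : {additive finz finA' -> finz finA} :=
    HB.pack pi0 (GRing.isZmodMorphism.Build _ _ pi0 piB).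
  by exists pi.
(* [(0, 1)] generates the kernel of the projection; [g] carries it to the representative. *)
apply: (@ncard_wedge2_step p (finz finA') (finz finA) pi (g (0, 1))).
- by move=> e; exists (g (f0 e, 0)); rewrite piE gK /= fK0.
- have -> : (g (0, 1) : finz finA') *+ p = g (((0, 1) : ext c) *+ p).
    by rewrite (morphDMn gD).
  by rewrite ext_vertMn FpMn// (morphD0 gD).
- move=> x; rewrite piE => x0; exists (f x).2.
  have f1 : (f x).1 = 0 by rewrite -(gK0 (f x).1) x0 (morphD0 fD0).
  have -> : (g (0, 1) : finz finA') *+ (f x).2 = g (((0, 1) : ext c) *+ (f x).2).
    by rewrite (morphDMn gD).
  rewrite ext_vertMn natr_Zp -f1 -[LHS]fK; congr g; by case: (f x).
Qed.

Definition law_moments (mu : nat -> probability fgab R) : Prop :=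
  forall G : fgab, finite_exp_dvd a G ->
    (\int[mu n]_x ((nSur (x : fgab) G)%:R)%:E)%E @[n --> \oo] -->
    ((ncard [set: wedge2 G])%:R : R)%:E.

Definition reduction_class (H : fgab) : set fgab :=
  [set x : fgab | zmod_iso (tensor x (int_mod a)) H].

Lemma fgab_discrete (A : set fgab) : measurable A.
Proof. by []. Qed.

Lemma reduction_class_inj (H H' x : fgab) :
  reduction_class H x -> reduction_class H' x -> H = H'.
Proof.
move=> Hx H'x; apply: fgab_group_inj.
exact: zmod_iso_trans (zmod_iso_sym Hx) H'x.
Qed.

Section OneLaw.
Variable mu : nat -> probability fgab R.
Hypothesis mu_mom : law_moments mu.

Lemma law_mcvg (G : finZmodType) : (forall x : G, x *+ a = 0) ->
  mcvg mu (fun x => #|surhom (reduction x) G|%:R) (wedge_moment G).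
Proof.
move=> aG; have isoG := fgab_of_iso G.
have aH := zmod_iso_kill (zmod_iso_sym isoG) aG.
apply: (lim_mcvg fgab_discrete) => [x|]; first exact: ler0n.
have GA : finite_exp_dvd a (fgab_of G).
  apply/finite_exp_dvdP => //; split=> //.
  apply: (zmod_iso_finite (zmod_iso_sym isoG)); exact: finite_finset.
apply: cvg_trans (mu_mom GA); apply: near_eq_cvg; near=> n; apply: eq_integral => x _.
by rewrite (nSur_reduction x (zmod_iso_sym isoG) aH).
Unshelve. all: by end_near. Qed.

Lemma law_class_mcvg (H : fgab) : finite_exp_dvd a H ->
  exists l, mcvg mu (\1_(reduction_class H) : fgab -> R) l.
Proof.
move=> /(finite_exp_dvdP _ a_gt0)[Hfin aH].
have [l lE] := iso_moment_cvg fgab_discrete a_gt0 reduction_kill law_mcvg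
  (fun p E c p_pr _ _ => @wedge_moment_ext p E c p_pr)
  (H := finz Hfin) aH.
pose N := #|[set g in surhom (finz Hfin) (finz Hfin) | injectiveb g]%SET|.
have N0 : (N%:R : R) != 0 by rewrite pnatr_eq0 -lt0n card_autos_gt0.
exists (N%:R^-1 * l); apply: mcvg_ext (mcvgZ N%:R^-1 lE) => x.
rewrite card_isos -/N natrM mulrCA mulVf// mulr1 indicE.
congr (_%:R); congr nat_of_bool; rewrite mem_setE.
Qed.

Lemma law_class_cvg (H : fgab) l :
  mcvg mu (\1_(reduction_class H) : fgab -> R) l ->
  mu n (reduction_class H) @[n --> \oo] --> l%:E.
Proof.
move=> lE; have := mcvg_lim (fun x => ler0n _ _) lE.
apply: cvg_trans; apply: near_eq_cvg; near=> n.
by rewrite integral_indic// setIT.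
Unshelve. all: by end_near. Qed.

Lemma nSur_class (H G x : fgab) (Gfin : finite_set [set: G]) :
  reduction_class H x -> nSur H G = #|surhom (reduction x) (finz Gfin)|.
Proof.
move=> Hx; apply: nSur_iso; last exact: finz_iso.
exact: zmod_iso_sym.
Qed.

(** A finite partial sum is the limiting mean of the surjection count restricted to finitely many
    classes, so it is at most the full moment. Conversely, the finitely many classes of order at
    most [N] miss at most the tail [e]. *)
Lemma law_sum (phi : fgab -> R) (G : fgab) :
  (forall H, finite_exp_dvd a H -> mcvg mu (\1_(reduction_class H) : fgab -> R) (phi H)) ->
  finite_exp_dvd a G ->
  (\esum_(H in finite_exp_dvd a) ((phi H)%:E * (nSur (H : fgab) G)%:R%:E) =
   ((ncard [set: wedge2 G])%:R : R)%:E)%E.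
Proof.
move=> phiE GA; have [Gfin aG] := (finite_exp_dvdP G a_gt0).1 GA.
set M : R := (ncard _)%:R.
have mM : mcvg mu (fun x => #|surhom (reduction x) (finz Gfin)|%:R) M.
  apply: (lim_mcvg fgab_discrete) => [x|]; first exact: ler0n.
  apply: cvg_trans (mu_mom GA); apply: near_eq_cvg; near=> n.
  by apply: eq_integral => x _; rewrite (nSur_reduction x (finz_iso Gfin) aG).
have phi_ge0 H : finite_exp_dvd a H -> 0 <= phi H.
  by move=> HA; apply: (mcvg_le _ (mcvg0 mu) (phiE H HA)) => x; rewrite indicE ler0n.
have sumE (X : set fgab) : finite_set X -> X `<=` finite_exp_dvd a ->
    mcvg mu (fun x => \sum_(H <- fset_set X) (nSur (H : fgab) G)%:R * \1_(reduction_class H) x)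
      (\sum_(H <- fset_set X) (nSur (H : fgab) G)%:R * phi H) /\
    (\sum_(H \in X) ((phi H)%:E * (nSur (H : fgab) G)%:R%:E) =
     (\sum_(H <- fset_set X) (nSur (H : fgab) G)%:R * phi H)%:E)%E.
  move=> Xfin XA; split.
    rewrite big_seq; apply: (mcvg_ext (f := fun x => \sum_(H <- fset_set X |
      H \in fset_set X) (nSur (H : fgab) G)%:R * \1_(reduction_class H) x)).
      by move=> x; rewrite [RHS]big_seq.
    apply: mcvg_sum => H; rewrite in_fset_set// => /set_mem/XA HA.
    by apply: mcvgZ; exact: phiE.
  rewrite fsbig_finite// -sumEFin; apply: eq_bigr => H _.
  by rewrite -EFinM mulrC.
apply/eqP; rewrite eq_le; apply/andP; split.
  apply: ub_ereal_sup => _ [X [Xfin XA] <-].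
  have [mX ->] := sumE X Xfin XA; rewrite lee_fin.
  apply: (mcvg_le _ mX mM) => x; apply: sum_indic_le => [||H H'|H Hx].
  - exact: fset_uniq.
  - exact: ler0n.
  - exact: reduction_class_inj.
  - by rewrite (nSur_class Gfin Hx).
apply/lee_addgt0Pr => e e0.
have [N [h [l [hl le h0 hN]]]] :=
  sur_moment_tail a_gt0 reduction_kill law_mcvg
  (fun p E c p_pr _ _ => @wedge_moment_ext p E c p_pr)
  (G := finz Gfin) aG e0.
pose X : set fgab := finite_exp_dvd a `&`
  [set H : fgab | finite_set [set: H] /\ (ncard [set: H] <= N)%N].
have Xfin : finite_set X by apply: finite_setIr; exact: finite_fgab_le.
have XA : X `<=` finite_exp_dvd a by move=> H [].
have [mX XE] := sumE X Xfin XA.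
apply: (@le_trans _ _ ((\sum_(H \in X) ((phi H)%:E * (nSur (H : fgab) G)%:R%:E)) + e%:E)%E).
  rewrite XE -EFinD lee_fin; apply: le_trans (lerD (lexx _) le).
  apply: (mcvg_le _ mM (mcvgD mX hl)) => x.
  have S0 : 0 <= \sum_(H <- fset_set X) (nSur (H : fgab) G)%:R * \1_(reduction_class H) x :> R.
    by apply: sumr_ge0 => H _; rewrite mulr_ge0// indicE ler0n.
  (* A large reduction is dominated by [h]; a small one has its class among the terms of the sum. *)
  have [xN|xN] := ltnP N #|reduction x|.
    by apply: (le_trans (hN x xN)); rewrite lerDr.
  pose H0 := fgab_of (reduction x).
  have iso0 : zmod_iso H0 (reduction x) by exact: fgab_of_iso.
  have H0x : reduction_class H0 x by exact: zmod_iso_sym.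
  have H0fin : finite_set [set: H0].
    apply: (zmod_iso_finite (zmod_iso_sym iso0)); exact: finite_finset.
  have H0X : H0 \in fset_set X.
    rewrite in_fset_set// inE; split.
      apply/finite_exp_dvdP => //; split=> //.
      by apply: (zmod_iso_kill (zmod_iso_sym iso0)); exact: reduction_kill.
    split=> //; apply: leq_trans xN; rewrite (ncard_finz H0fin).
    have [f [g [_ _ fK _]]] := zmod_iso_inv iso0.
    by apply: (@leq_card (finz H0fin) (reduction x) f); exact: can_inj fK.
  rewrite -(nSur_class Gfin H0x) -[X in X <= _]addr0; apply: lerD (h0 x).
  exact: (le_sum_indic H0X (fun H => ler0n R (nSur (H : fgab) G)) H0x).
rewrite leeD2r//; apply: ereal_sup_ubound; by exists X.
Unshelve. all: by end_near. Qed.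

End OneLaw.

Lemma cvg_interleave (T : topologicalType) (u v : nat -> T) (l : T) :
  u @ \oo --> l -> v @ \oo --> l ->
  (if odd n then v n./2 else u n./2) @[n --> \oo] --> l.
Proof.
move=> ul vl A Al; have [N _ uN] := ul A Al; have [N' _ vN] := vl A Al.
exists ((N + N').*2) => // n /= nN.
have hN : (N + N' <= n./2)%N by rewrite -[X in (X <= _)%N](doubleK (N + N')%N) half_leq.
case: ifP => _; [apply: vN => /=|apply: uN => /=]; apply: leq_trans hN.
  exact: leq_addl.
exact: leq_addr.
Qed.

(** The interleaved sequence satisfies the same moment hypothesis, so existence of its limit
    applies; [mu] and [nu] are its even and odd subsequences. *)
Lemma law_class_unique (mu nu : nat -> probability fgab R) (H : fgab) :
  law_moments mu -> law_moments nu -> finite_exp_dvd a H ->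
  limn (fun n => mu n (reduction_class H)) =
  limn (fun n => nu n (reduction_class H)).
Proof.
move=> mmu mnu HA.
pose xi n := if odd n then nu n./2 else mu n./2.
have mxi : law_moments xi.
  move=> G GA; apply: cvg_trans (cvg_interleave (mmu G GA) (mnu G GA)).
  by apply: near_eq_cvg; near=> n; rewrite /xi; case: odd.
have [l lE] := law_class_mcvg mxi HA.
have xil := law_class_cvg lE.
have sub (f : nat -> nat) : (forall n, (n <= f n)%N) ->
    xi (f n) (reduction_class H) @[n --> \oo] --> l%:E.
  move=> fn A Al; have [N _ xN] := xil A Al; exists N => // n /= nN.
  by apply: xN => /=; exact: leq_trans (fn n).
have -> : limn (fun n => mu n (reduction_class H)) = l%:E.
  apply: cvg_lim => //; have := sub double; rewrite /xi.
  under eq_fun do rewrite odd_double doubleK.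
  by apply=> n; rewrite -addnn leq_addr.
apply/esym; apply: cvg_lim => //; have := sub (fun n => n.*2.+1); rewrite /xi.
under eq_fun do rewrite /= odd_double /= uphalf_double.
by apply=> n; rewrite -addnn ltnW// ltnS leq_addr.
Unshelve. all: by end_near. Qed.

End Laws.

Section Distributions.
Local Open Scope classical_set_scope.
Context (R : realType) (a : nat) (a_gt0 : (0 < a)%N).

(** The probability spaces vary with [n]; passing to laws puts everything on [fgab], where sequences
    can be compared and interleaved. *)
Lemma distribution_moments (d : nat -> measure_display)
    (T : forall n, measurableType (d n)) (P : forall n, probability (T n) R)
    (X : forall n, {RV (P n) >-> fgab}) :
  (forall G : fgab, finite_exp_dvd a G ->
    ('E_(P n)[fun w => (nSur (X n w : fgab) G)%:R%R])%E @[n --> \oo]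
      --> ((ncard [set: wedge2 G])%:R%R%:E : \bar R)) ->
  law_moments a (fun n => distribution (P n) (X n)).
Proof.
move=> mom G GA; apply: cvg_trans (mom G GA); apply: near_eq_cvg; near=> n.
rewrite unlock (ge0_integral_distribution (X n)
  (f := fun x => ((nSur (x : fgab) G)%:R : R)%:E))//.
Unshelve. all: by end_near. Qed.

End Distributions.
Local Open Scope classical_set_scope.
Local Open Scope ring_scope.
Local Open Scope ereal_scope.

Theorem theorem8p3 (R : realType)
    (d : nat -> measure_display) (T : forall n, measurableType (d n))
    (P : forall n, probability (T n) R)
    (X : forall n, {RV (P n) >-> fgab})
    (a : nat) (a_gt0 : (0 < a)%N)
    (momX : forall G : fgab, finite_exp_dvd a G ->
      'E_(P n)[fun w => (nSur (X n w : fgab) G)%:R%R] @[n --> \oo]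
        --> (ncard [set: wedge2 G])%:R%R%:E) :
  [/\ (forall H : fgab, finite_exp_dvd a H ->
        cvgn (fun n => P n
          [set w | zmod_iso (tensor (X n w : fgab) (int_mod a)) H])),
      (forall G : fgab, finite_exp_dvd a G ->
        \esum_(H in finite_exp_dvd a)
          (limn (fun n => P n
             [set w | zmod_iso (tensor (X n w : fgab) (int_mod a)) (H : fgab)])
           * (nSur (H : fgab) G)%:R%R%:E)
        = (ncard [set: wedge2 G])%:R%R%:E)
    & forall (d' : nat -> measure_display)
        (T' : forall n, measurableType (d' n))
        (Q : forall n, probability (T' n) R)
        (Y : forall n, {RV (Q n) >-> fgab}),
      (forall G : fgab, finite_exp_dvd a G ->
        'E_(Q n)[fun w => (nSur (Y n w : fgab) G)%:R%R] @[n --> \oo]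
          --> (ncard [set: wedge2 G])%:R%R%:E) ->
      forall H : fgab, finite_exp_dvd a H ->
        limn (fun n => P n
            [set w | zmod_iso (tensor (X n w : fgab) (int_mod a)) H])
        = limn (fun n => Q n
            [set w | zmod_iso (tensor (Y n w : fgab) (int_mod a)) H])].
Proof.
have mu_mom := distribution_moments momX.
have /boolp.choice[phi phiE] (H : fgab) : exists l, finite_exp_dvd a H ->
    mcvg (fun n => distribution (P n) (X n))
      (\1_(reduction_class a H) : fgab -> R) l.
  have [HA|nHA] := pselect (finite_exp_dvd a H); last by exists 0%R.
  by have [l lE] := law_class_mcvg a_gt0 mu_mom HA; exists l.
have limE H (HA : finite_exp_dvd a H) := law_class_cvg (phiE H HA).
(* The law of [X n] at a class is by conversion the probability in the statement. *)
split.
- by move=> H HA; apply: cvgP (limE H HA).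
- move=> G GA; rewrite -(law_sum a_gt0 mu_mom phiE GA).
  apply: eq_esum => H HA; congr (_ * _).
  by apply: cvg_lim => //; exact: limE H HA.
- move=> d' T' Q Y momY H HA.
  exact: (law_class_unique a_gt0 mu_mom (distribution_moments momY) HA).
Qed.
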